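(* Let $B$ be a commutative algebra with a left action of a group $\Gamma$, let $\gamma_1,\dots,\gamma_n\in\Gamma$, $\nabla=\mathrm{diag}(\gamma_1,\dots,\gamma_n)\in M_n(B\rtimes\Gamma)$, and let $F\in GL_n(B)$ be $\nabla$-odd, i.e. $\nabla F\nabla\in M_n(B)$. Let $A^B_{\mathrm o}(\nabla,F)$ be the free orthogonal dynamical quantum group with fundamental matrix $v$, and put $H=(\nabla F\nabla)^{\mathsf T}F^{-1}\in M_n(B)$. Then $H$ is an intertwiner from $v$ to $S_n^2(v)$, that is, $\nabla H\nabla^{-1}\in M_n(B)$ and $r_n(\nabla H\nabla^{-1})\,v=S_n^2(v)\,s_n(H)$, and $A^B_{\mathrm o}(\nabla,F)$ has a scaling character group $\theta=(\theta^{(k)})_{k\in\mathbb Z}$ such that $\theta^{(k)}_n(v)=\nabla H^k$ for all $k\in\mathbb Z$.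
   Context: All algebras and homomorphisms are unital over a fixed ground field. $B$ is a commutative algebra on which the group $\Gamma$ acts from the left by automorphisms; $e\in\Gamma$ is the unit. A $(B,\Gamma)$-algebra is an algebra $A$ with a grading $A=\bigoplus_{\gamma,\gamma'\in\Gamma}A_{\gamma,\gamma'}$ (with $A_{\gamma,\gamma'}A_{\beta,\beta'}\subseteq A_{\gamma\beta,\gamma'\beta'}$) and homomorphisms $r,s\colon B\to A_{e,e}$ with commuting images such that $a\,r(b)=r(\gamma(b))a$ and $a\,s(b)=s(\gamma'(b))a$ for all $a\in A_{\gamma,\gamma'}$, $b\in B$. Morphisms are grading-preserving homomorphisms compatible with $r$ and $s$. The crossed product $B\rtimes\Gamma$ is spanned by elements $b\gamma$ with $b\gamma\cdot b'\gamma'=b\gamma(b')\gamma\gamma'$; it is a $(B,\Gamma)$-algebra with $b\gamma$ in degree $(\gamma,\gamma)$ and $r(b)=s(b)=b$. $M_n(B)$ is viewed inside $M_n(B\rtimes\Gamma)$. $S^{B\rtimes\Gamma}$ denotes the anti-automorphism $b\gamma\mapsto\gamma^{-1}b$ of $B\rtimes\Gamma$. Fiber product: for $(B,\Gamma)$-algebras $A,C$ let $A\overset{\Gamma}{\otimes}C=\sum_{\gamma,\gamma',\gamma''}A_{\gamma,\gamma'}\otimes C_{\gamma',\gamma''}\subseteq A\otimes C$, and let $A\tilde\otimes C$ be its quotient by the ideal generated by $\{s_A(b)\otimes1-1\otimes r_C(b):b\in B\}$. It is a $(B,\Gamma)$-algebra with $A_{\gamma,\gamma'}\tilde\otimes C_{\gamma',\gamma''}$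 in degree $(\gamma,\gamma'')$ and $r(b)=r_A(b)\tilde\otimes1$, $s(b)=1\tilde\otimes s_C(b)$. It is functorial and associative, and $(B\rtimes\Gamma)\tilde\otimes A\cong A$ via $b\gamma\tilde\otimes a\mapsto r(b)a$, $A\tilde\otimes(B\rtimes\Gamma)\cong A$ via $a\tilde\otimes b\gamma\mapsto s(b)a$. $A^{\mathsf{co},\mathsf{op}}$ is the opposite algebra of $A$ with $(A^{\mathsf{co},\mathsf{op}})_{\gamma,\gamma'}=A_{\gamma'^{-1},\gamma^{-1}}$, $r_{A^{\mathsf{co},\mathsf{op}}}=s_A$, $s_{A^{\mathsf{co},\mathsf{op}}}=r_A$. A $(B,\Gamma)$-Hopf algebroid is a $(B,\Gamma)$-algebra $A$ with morphisms of $(B,\Gamma)$-algebras $\Delta\colon A\to A\tilde\otimes A$, $\epsilon\colon A\to B\rtimes\Gamma$, $S\colon A\to A^{\mathsf{co},\mathsf{op}}$ such that $(\Delta\tilde\otimes\mathrm{id})\Delta=(\mathrm{id}\tilde\otimes\Delta)\Delta$, $(\epsilon\tilde\otimes\mathrm{id})\Delta=\mathrm{id}=(\mathrm{id}\tilde\otimes\epsilon)\Delta$ (using the isomorphisms $(B\rtimes\Gamma)\tilde\otimes A\cong A$, $b\gamma\tilde\otimes a\mapsto r(b)a$, and $A\tilde\otimes(B\rtimes\Gamma)\cong A$, $a\tilde\otimes b\gamma\mapsto s(b)a$), and, writing $\Delta(a)=\sum a_{(1)}\tilde\otimes a_{(2)}$, $\sum S(a_{(1)})a_{(2)}=\check s(\epsilon(a))$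 and $\sum a_{(1)}S(a_{(2)})=\hat r(\epsilon(a))$, where $\check s(\gamma b)=s(b)$, $\hat r(b\gamma)=r(b)$. The free orthogonal dynamical quantum group $A^B_{\mathrm o}(\nabla,F)$ is the universal $(B,\Gamma)$-algebra with an invertible $n\times n$-matrix $v$ such that $v_{ij}$ has degree $(\gamma_i,\gamma_j)$ and $r_n(\nabla F\nabla)v^{-\mathsf T}=vs_n(F)$, where $v^{-\mathsf T}=(v^{-1})^{\mathsf T}$; it carries the unique $(B,\Gamma)$-Hopf algebroid structure with $\Delta(v_{ij})=\sum_kv_{ik}\tilde\otimes v_{kj}$, $\epsilon(v_{ij})=\delta_{i,j}\gamma_i$, $S(v_{ij})=(v^{-1})_{ij}$. A character group on a $(B,\Gamma)$-Hopf algebroid $(A,\Delta,\epsilon,S)$ is a family of morphisms of $(B,\Gamma)$-algebras $\theta^{(k)}\colon A\to B\rtimes\Gamma$, $k\in\mathbb Z$, with $(\theta^{(k)}\tilde\otimes\theta^{(l)})\circ\Delta=\theta^{(k+l)}$ (identifying $(B\rtimes\Gamma)\tilde\otimes(B\rtimes\Gamma)\cong B\rtimes\Gamma$ via $b\gamma\tilde\otimes b'\gamma\mapsto bb'\gamma$), $\theta^{(0)}=\epsilon$ and $\theta^{(k)}\circ S=S^{B\rtimes\Gamma}\circ\theta^{(-k)}$ for all $k,l$. It is scaling if $S^2=(\theta^{(1)}\tilde\otimes\mathrm{id}\tilde\otimes\theta^{(-1)})\circ\Delta^{(2)}$, where $\Delta^{(2)}=(\Delta\tilde\otimes\mathrm{id})\circ\Delta$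 (identifying $(B\rtimes\Gamma)\tilde\otimes A\tilde\otimes(B\rtimes\Gamma)\cong A$ via $b\gamma\tilde\otimes a\tilde\otimes b'\gamma'\mapsto r(b)s(b')a$). For a linear map $\phi$, $\phi_n$ denotes its entrywise extension to $n\times n$-matrices. *)

(* Defs.v *)
From HB Require Import structures.
From mathcomp Require Import all_boot all_algebra.
From mathcomp Require Import finmap boolp.
From mathcomp Require Import monalg.

Set Implicit Arguments.
Unset Strict Implicit.
Unset Printing Implicit Defensive.

Import GRing.Theory.

Local Open Scope ring_scope.
Local Open Scope quotient_scope.

(* GRing.Algebra excludes the zero algebra, but a fiber product of nonzero
   algebras can be zero, so unital k-algebras are axiomatized here without
   1 != 0. *)
HB.mixin Record isPzAlgebra (k : pzRingType) A of GRing.PzRing A := {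
  pzscale : k -> A -> A;
  pzscaleA : forall c d x, pzscale c (pzscale d x) = pzscale (c * d) x;
  pzscale1 : forall x, pzscale 1 x = x;
  pzscaleDr : forall c x y, pzscale c (x + y) = pzscale c x + pzscale c y;
  pzscaleDl : forall x c d, pzscale (c + d) x = pzscale c x + pzscale d x;
  pzscaleAl : forall c x y, pzscale c (x * y) = pzscale c x * y;
  pzscaleAr : forall c x y, pzscale c (x * y) = x * pzscale c y
}.

#[short(type="pzAlgType")]
HB.structure Definition PzAlgebra (k : pzRingType) :=
  {A of GRing.PzRing A & isPzAlgebra k A}.

#[short(type="comPzAlgType")]
HB.structure Definition ComPzAlgebra (k : pzRingType) :=
  {A of GRing.ComPzRing A & PzAlgebra k A}.

Reserved Notation "c *:k x" (at level 40).
Notation "c *:k x" := (pzscale c x) : ring_scope.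

Lemma regular_pzscaleAr (k : comPzRingType) (c x y : k) :
  c * (x * y) = x * (c * y).
Proof. exact: mulrCA. Qed.

HB.instance Definition _ (k : comPzRingType) :=
  isPzAlgebra.Build k (k^o)%type (@mulrA k) (@mul1r k) (@mulrDr k)
    (fun x c d => mulrDl c d x) (@mulrA k) (@regular_pzscaleAr k).

HB.instance Definition _ (k : pzRingType) (A : pzAlgType k) :=
  isPzAlgebra.Build k (A^c)%type (@pzscaleA k A) (@pzscale1 k A)
    (@pzscaleDr k A) (@pzscaleDl k A)
    (fun c x y => pzscaleAr c y x) (fun c x y => pzscaleAl c y x).

Section AlgebraBasics.
Variable k : pzRingType.

Lemma pzscale0r (A : pzAlgType k) (x : A) : 0 *:k x = 0.
Proof. by apply: (addIr (0 *:k x)); rewrite -pzscaleDl !add0r. Qed.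

Lemma pzscaler0 (A : pzAlgType k) c : c *:k (0 : A) = 0.
Proof. by apply: (addIr (c *:k 0)); rewrite -pzscaleDr !add0r. Qed.

Lemma pzscaleN1 (A : pzAlgType k) (x : A) : (-1) *:k x = - x.
Proof.
by apply: (addIr x); rewrite addNr -{2}(pzscale1 x) -pzscaleDl addNr pzscale0r.
Qed.

Lemma pzscalerN (A : pzAlgType k) c (x : A) : c *:k (- x) = - (c *:k x).
Proof. by apply: (addIr (c *:k x)); rewrite -pzscaleDr !addNr pzscaler0. Qed.

Lemma pzscale_sumr (A : pzAlgType k) c I (s : seq I) (P : pred I) (F : I -> A) :
  c *:k (\sum_(i <- s | P i) F i) = \sum_(i <- s | P i) c *:k F i.
Proof.
by apply: (big_morph (pzscale c)) => [x y|]; rewrite ?pzscaleDr ?pzscaler0.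
Qed.

Definition klinear (A C : pzAlgType k) (f : A -> C) :=
  {morph f : x y / x + y} /\ (forall c, {morph f : x / c *:k x}).

Definition alg_morphism (A C : pzAlgType k) (f : A -> C) :=
  klinear f /\ monoid_morphism f.

Lemma klin0 (A C : pzAlgType k) (f : A -> C) : klinear f -> f 0 = 0.
Proof. by case=> fD _; apply: (addIr (f 0)); rewrite -fD !add0r. Qed.

Lemma klin_sum (A C : pzAlgType k) (f : A -> C) I (s : seq I) (P : pred I)
    (F : I -> A) :
  klinear f -> f (\sum_(i <- s | P i) F i) = \sum_(i <- s | P i) f (F i).
Proof. by move=> fL; apply: (big_morph f fL.1); apply: klin0. Qed.

Lemma klinN (A C : pzAlgType k) (f : A -> C) x : klinear f -> f (- x) = - f x.
Proof. by move=> fL; rewrite -!pzscaleN1 fL.2. Qed.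

Lemma klinB (A C : pzAlgType k) (f : A -> C) x y :
  klinear f -> f (x - y) = f x - f y.
Proof. by move=> fL; rewrite fL.1 klinN. Qed.

Lemma klin_comp (A C D : pzAlgType k) (f : C -> D) (g : A -> C) :
  klinear f -> klinear g -> klinear (f \o g).
Proof.
by move=> fL gL; split=> [x y|c x] /=; rewrite ?gL.1 ?fL.1 // gL.2 fL.2.
Qed.

Section Span.
Variables (A : pzAlgType k) (S : A -> Prop).

Inductive span : A -> Prop :=
| span0 : span 0
| spanS c x y : S x -> span y -> span (c *:k x + y).

Lemma span_mem x : S x -> span x.
Proof. by move=> Sx; rewrite -[x]addr0 -[x]pzscale1; apply/spanS/span0. Qed.

Lemma spanD x y : span x -> span y -> span (x + y).
Proof.
move=> + Sy; elim=> [|c z t Sz _ IH]; first by rewrite add0r.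
by rewrite -addrA; apply: spanS.
Qed.

Lemma spanZ c x : span x -> span (c *:k x).
Proof.
elim=> [|d y z Sy _ IH]; first by rewrite pzscaler0; apply: span0.
by rewrite pzscaleDr pzscaleA; apply: spanS.
Qed.

Lemma spanN x : span x -> span (- x).
Proof. by rewrite -pzscaleN1; apply: spanZ. Qed.

Lemma spanB x y : span x -> span y -> span (x - y).
Proof. by move=> Sx Sy; apply/spanD/spanN. Qed.

Lemma span_sum I (s : seq I) (F : I -> A) :
  (forall i, span (F i)) -> span (\sum_(i <- s) F i).
Proof.
move=> SF; elim: s => [|i s IH]; first by rewrite big_nil; apply: span0.
by rewrite big_cons; apply: spanD.
Qed.

End Span.

Lemma span_sub (A : pzAlgType k) (S T : A -> Prop) x :
  (forall y, S y -> span T y) -> span S x -> span T x.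
Proof.
move=> ST; elim=> [|c y z Sy _ IH]; first exact: span0.
by apply: spanD => //; apply/spanZ/ST.
Qed.

Lemma span_mor (A C : pzAlgType k) (f : A -> C) (S : A -> Prop)
    (T : C -> Prop) x :
  klinear f -> (forall y, S y -> span T (f y)) -> span S x -> span T (f x).
Proof.
move=> fL ST; elim=> [|c y z Sy _ IH]; first by rewrite klin0 //; apply: span0.
by rewrite fL.1 fL.2; apply: spanD => //; apply/spanZ/ST.
Qed.

Lemma span_eq0 (A C : pzAlgType k) (f : A -> C) (S : A -> Prop) x :
  klinear f -> (forall y, S y -> f y = 0) -> span S x -> f x = 0.
Proof.
move=> fL f0; elim=> [|c y z Sy _ IH]; first exact: klin0.
by rewrite fL.1 fL.2 IH f0 // pzscaler0 addr0.
Qed.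

Lemma span_eq (A C : pzAlgType k) (f g : A -> C) (S : A -> Prop) x :
  klinear f -> klinear g -> (forall y, S y -> f y = g y) -> span S x ->
  f x = g x.
Proof.
move=> fL gL fg; elim=> [|c y z Sy _ IH]; first by rewrite !klin0.
by rewrite fL.1 gL.1 fL.2 gL.2 IH fg.
Qed.

Lemma span_mul (A : pzAlgType k) (S T U : A -> Prop) x y :
  (forall x y, S x -> T y -> span U (x * y)) -> span S x -> span T y ->
  span U (x * y).
Proof.
move=> STU Sx Ty; elim: Sx => [|c z t Sz _ IH].
  by rewrite mul0r; apply: span0.
rewrite mulrDl -pzscaleAl; apply: spanD => //; apply: spanZ.
elim: Ty => [|d u w Tu _ IH']; first by rewrite mulr0; apply: span0.
by rewrite mulrDr -pzscaleAr; apply: spanD => //; apply/spanZ/STU.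
Qed.

End AlgebraBasics.

Section QuotientAlgebra.
Variables (k : pzRingType) (R : pzAlgType k) (S : R -> Prop).

Definition ideal_gen : R -> Prop :=
  span (fun z => exists x g y, S g /\ z = x * g * y).

Lemma ideal_mull x z : ideal_gen z -> ideal_gen (x * z).
Proof.
apply: (span_mor (f := fun z => x * z)).
  by split=> [y t|c y]; rewrite ?mulrDr ?pzscaleAr.
move=> _ [y [g [t [Sg ->]]]]; apply: span_mem.
by exists (x * y), g, t; rewrite !mulrA.
Qed.

Lemma ideal_mulr x z : ideal_gen z -> ideal_gen (z * x).
Proof.
apply: (span_mor (f := fun z => z * x)).
  by split=> [y t|c y]; rewrite ?mulrDl ?pzscaleAl.
move=> _ [y [g [t [Sg ->]]]]; apply: span_mem.
by exists y, g, (t * x); rewrite !mulrA.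
Qed.

Definition ideal_eqv (x y : R) : bool := `[< ideal_gen (x - y) >].

Lemma ideal_eqv_refl : reflexive ideal_eqv.
Proof. by move=> x; apply/asboolP; rewrite subrr; apply: span0. Qed.

Lemma ideal_eqv_sym : symmetric ideal_eqv.
Proof.
by move=> x y; apply/asboolP/asboolP => /spanN; rewrite opprB.
Qed.

Lemma ideal_eqv_trans : transitive ideal_eqv.
Proof.
move=> y x z /asboolP xy /asboolP yz; apply/asboolP.
by rewrite -(subrKA y); apply: spanD.
Qed.

Canonical ideal_eqv_equiv :=
  EquivRel ideal_eqv ideal_eqv_refl ideal_eqv_sym ideal_eqv_trans.

Definition quot_alg := {eq_quot ideal_eqv}.
HB.instance Definition _ := Choice.on quot_alg.
HB.instance Definition _ := EqQuotient.on quot_alg.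

Definition qpi (x : R) : quot_alg := \pi_quot_alg x.

Lemma qpiE x y : qpi x = qpi y <-> ideal_gen (x - y).
Proof.
split=> [/eqP|xy]; first by rewrite /qpi eqmodE => /asboolP.
by apply/eqP; rewrite /qpi eqmodE; apply/asboolP.
Qed.

Lemma qpiK (u : quot_alg) : qpi (repr u) = u.
Proof. exact: reprK. Qed.

Lemma repr_qpi x : ideal_gen (repr (qpi x) - x).
Proof. by apply/qpiE; rewrite qpiK. Qed.

Fact quot_key : unit. Proof. by []. Qed.
Definition qadd := locked_with quot_key
  (fun u w : quot_alg => qpi (repr u + repr w)).
Definition qopp := locked_with quot_key
  (fun u : quot_alg => qpi (- repr u)).
Definition qmul := locked_with quot_key
  (fun u w : quot_alg => qpi (repr u * repr w)).
Definition qscale := locked_with quot_key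
  (fun c (u : quot_alg) => qpi (c *:k repr u)).

Lemma qaddE x y : qadd (qpi x) (qpi y) = qpi (x + y).
Proof.
rewrite /qadd !locked_withE.
by apply/qpiE; rewrite opprD addrACA; apply: spanD; apply: repr_qpi.
Qed.

Lemma qoppE x : qopp (qpi x) = qpi (- x).
Proof.
rewrite /qopp !locked_withE. by apply/qpiE; rewrite -opprD; apply/spanN/repr_qpi. Qed.

Lemma qmulE x y : qmul (qpi x) (qpi y) = qpi (x * y).
Proof.
rewrite /qmul !locked_withE.
apply/qpiE; rewrite -(subrKA (repr (qpi x) * y)) -mulrBr -mulrBl.
by apply: spanD; [apply/ideal_mull/repr_qpi | apply/ideal_mulr/repr_qpi].
Qed.

Lemma qscaleE c x : qscale c (qpi x) = qpi (c *:k x).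
Proof.
rewrite /qscale !locked_withE.
by apply/qpiE; rewrite -pzscalerN -pzscaleDr; apply/spanZ/repr_qpi.
Qed.

Let qE := (qaddE, qoppE, qmulE, qscaleE).

Lemma qaddA : associative qadd.
Proof. by move=> u w t; rewrite -(qpiK u) -(qpiK w) -(qpiK t) !qE addrA. Qed.
Lemma qaddC : commutative qadd.
Proof. by move=> u w; rewrite -(qpiK u) -(qpiK w) !qE addrC. Qed.
Lemma qadd0 : left_id (qpi 0) qadd.
Proof. by move=> u; rewrite -(qpiK u) !qE add0r. Qed.
Lemma qaddN : left_inverse (qpi 0) qopp qadd.
Proof. by move=> u; rewrite -(qpiK u) !qE addNr. Qed.
HB.instance Definition _ := GRing.isZmodule.Build quot_alg qaddA qaddC qadd0 qaddN.

Lemma qmulA : associative qmul.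
Proof. by move=> u w t; rewrite -(qpiK u) -(qpiK w) -(qpiK t) !qE mulrA. Qed.
Lemma qmul1 : left_id (qpi 1) qmul.
Proof. by move=> u; rewrite -(qpiK u) !qE mul1r. Qed.
Lemma qmulr1 : right_id (qpi 1) qmul.
Proof. by move=> u; rewrite -(qpiK u) !qE mulr1. Qed.
Lemma qmulDl : left_distributive qmul +%R.
Proof.
move=> u w t; rewrite -(qpiK u) -(qpiK w) -(qpiK t).
by rewrite /+%R /= !qE mulrDl.
Qed.
Lemma qmulDr : right_distributive qmul +%R.
Proof.
move=> u w t; rewrite -(qpiK u) -(qpiK w) -(qpiK t).
by rewrite /+%R /= !qE mulrDr.
Qed.
HB.instance Definition _ :=
  GRing.Zmodule_isPzRing.Build quot_alg qmulA qmul1 qmulr1 qmulDl qmulDr.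

Lemma qscaleA c d u : qscale c (qscale d u) = qscale (c * d) u.
Proof. by rewrite -(qpiK u) !qE pzscaleA. Qed.
Lemma qscale1 u : qscale 1 u = u.
Proof. by rewrite -(qpiK u) !qE pzscale1. Qed.
Lemma qscaleDr c (u w : quot_alg) : qscale c (u + w) = qscale c u + qscale c w.
Proof. by rewrite -(qpiK u) -(qpiK w) /+%R /= !qE pzscaleDr. Qed.
Lemma qscaleDl u c d : qscale (c + d) u = qscale c u + qscale d u.
Proof. by rewrite -(qpiK u) /+%R /= !qE pzscaleDl. Qed.
Lemma qscaleAl c (u w : quot_alg) : qscale c (u * w) = qscale c u * w.
Proof. by rewrite -(qpiK u) -(qpiK w) /*%R /= !qE pzscaleAl. Qed.
Lemma qscaleAr c (u w : quot_alg) : qscale c (u * w) = u * qscale c w.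
Proof. by rewrite -(qpiK u) -(qpiK w) /*%R /= !qE pzscaleAr. Qed.
HB.instance Definition _ := isPzAlgebra.Build k quot_alg
  qscaleA qscale1 qscaleDr qscaleDl qscaleAl qscaleAr.

Lemma qpi_lin : klinear qpi.
Proof. by split=> [x y|c x]; rewrite -?qaddE -?qscaleE. Qed.

Lemma qpi_mor : alg_morphism qpi.
Proof. by split; [exact: qpi_lin | split=> // x y; rewrite -qmulE]. Qed.

Lemma qpi_rel x y : S (x - y) -> qpi x = qpi y.
Proof.
by move=> Sxy; apply/qpiE/span_mem; exists 1, (x - y), 1; rewrite mul1r mulr1.
Qed.

End QuotientAlgebra.

Arguments qpi {k R} S x.

Section SubAlgebra.
Variables (k : pzRingType) (R : pzAlgType k).

Record subalgebra := Subalgebra {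
  sa_mem :> R -> Prop;
  sa_mem1 : sa_mem 1;
  sa_memB : forall x y, sa_mem x -> sa_mem y -> sa_mem (x - y);
  sa_memM : forall x y, sa_mem x -> sa_mem y -> sa_mem (x * y);
  sa_memZ : forall c x, sa_mem x -> sa_mem (c *:k x)
}.

Variable P : subalgebra.

Definition sa_pred : {pred R} := fun x => `[< P x >].

Lemma sa_predP x : (x \in sa_pred) <-> P x.
Proof. by split=> [/asboolP|Px] //; apply/asboolP. Qed.

Lemma sa_pred_subring : subring_closed sa_pred.
Proof.
split=> [|x y /sa_predP Px /sa_predP Py|x y /sa_predP Px /sa_predP Py];
  apply/sa_predP; [exact: sa_mem1 | exact: sa_memB | exact: sa_memM].
Qed.
HB.instance Definition _ := GRing.isSubringClosed.Build R sa_pred sa_pred_subring.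

Record sub_alg := SubAlg { sub_val : R; sub_valP : sub_val \in sa_pred }.
HB.instance Definition _ := [isSub for sub_val].
HB.instance Definition _ := [Choice of sub_alg by <:].
HB.instance Definition _ :=
  GRing.SubChoice_isSubPzRing.Build R sa_pred sub_alg sa_pred_subring.

Definition sub_scale c (x : sub_alg) : sub_alg :=
  SubAlg ((sa_predP _).2 (sa_memZ c ((sa_predP _).1 (sub_valP x)))).

Lemma sub_scaleA c d x : sub_scale c (sub_scale d x) = sub_scale (c * d) x.
Proof. by apply: val_inj; rewrite /= pzscaleA. Qed.
Lemma sub_scale1 x : sub_scale 1 x = x.
Proof. by apply: val_inj; rewrite /= pzscale1. Qed.
Lemma sub_scaleDr c x y : sub_scale c (x + y) = sub_scale c x + sub_scale c y.
Proof. by apply: val_inj; rewrite /= pzscaleDr. Qed.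
Lemma sub_scaleDl x c d : sub_scale (c + d) x = sub_scale c x + sub_scale d x.
Proof. by apply: val_inj; rewrite /= pzscaleDl. Qed.
Lemma sub_scaleAl c x y : sub_scale c (x * y) = sub_scale c x * y.
Proof. by apply: val_inj; rewrite /= pzscaleAl. Qed.
Lemma sub_scaleAr c x y : sub_scale c (x * y) = x * sub_scale c y.
Proof. by apply: val_inj; rewrite /= pzscaleAr. Qed.
HB.instance Definition _ := isPzAlgebra.Build k sub_alg
  sub_scaleA sub_scale1 sub_scaleDr sub_scaleDl sub_scaleAl sub_scaleAr.

Lemma sub_val_lin : klinear sub_val.
Proof. by []. Qed.

Lemma sub_val_mor : alg_morphism sub_val.
Proof. by []. Qed.

Lemma sub_mem (x : sub_alg) : P (sub_val x).
Proof. exact/sa_predP/sub_valP. Qed.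

Definition sub_in (x : R) : sub_alg := insubd (0 : sub_alg) x.

Lemma sub_inE x : P x -> sub_val (sub_in x) = x.
Proof. by move=> Px; rewrite insubdK //; apply/sa_predP. Qed.

Lemma sub_valK x : sub_in (sub_val x) = x.
Proof. by apply: val_inj; rewrite /= sub_inE //; apply: sub_mem. Qed.

End SubAlgebra.

Section MalgLinear.
Variables (M : choiceType) (R V : zmodType).

Definition mlin (f : M -> R -> V) (g : {malg R[M]}) : V :=
  \sum_(m <- msupp g) f m g@_m.

Variable f : M -> R -> V.
Hypothesis fD : forall m, {morph f m : x y / x + y}.

Lemma mlin_f0 m : f m 0 = 0.
Proof. by apply: (addIr (f m 0)); rewrite -fD !add0r. Qed.

Lemma mlinEw (d : {fset M}) g : (msupp g `<=` d)%fset ->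
  mlin f g = \sum_(m <- d) f m g@_m.
Proof.
move=> le_gd; rewrite /mlin (big_fset_incl _ le_gd) // => m _ /mcoeff_outdom ->.
exact: mlin_f0.
Qed.

Lemma mlinD : {morph mlin f : g h / g + h}.
Proof.
move=> g h; pose d := (msupp g `|` msupp h)%fset.
rewrite (@mlinEw d g) ?fsubsetUl // (@mlinEw d h) ?fsubsetUr //.
rewrite (@mlinEw d) ?msuppD_le // -big_split; apply: eq_bigr => m _.
by rewrite mcoeffD fD.
Qed.

Lemma mlin0 : mlin f 0 = 0.
Proof. by rewrite /mlin msupp0 big_seq_fset0. Qed.

Lemma mlin_sum I (s : seq I) (F : I -> {malg R[M]}) :
  mlin f (\sum_(i <- s) F i) = \sum_(i <- s) mlin f (F i).
Proof.
by elim: s => [|i s IH]; rewrite ?big_nil ?mlin0 // !big_cons mlinD IH.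
Qed.

Lemma mlinU m x : mlin f << x *g m >> = f m x.
Proof.
rewrite (@mlinEw [fset m]%fset) ?msuppU_le // big_seq_fset1.
by rewrite mcoeffUU.
Qed.

End MalgLinear.

Lemma mlin_eq (M : choiceType) (R V : zmodType) (f f' : M -> R -> V) g :
  (forall m x, f m x = f' m x) -> mlin f g = mlin f' g.
Proof. by move=> ff'; apply: eq_bigr => m _; rewrite ff'. Qed.

Lemma malg_ind (M : choiceType) (R : zmodType) (P : {malg R[M]} -> Prop) :
  P 0 -> (forall m x, P << x *g m >>) -> (forall g h, P g -> P h -> P (g + h)) ->
  forall g, P g.
Proof.
move=> P0 PU PD g; rewrite [g]monalgE.
by apply: (big_ind P) => // m _; apply: PU.
Qed.

(* Finitely supported formal sums \sum_m x_m m over a monoid (M, e, op)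
   acting on the coefficients, with (x m)(y n) = (x act_m(y)) (op m n). *)
Section SkewMonoidAlgebra.
Variables (k : pzRingType) (R : pzAlgType k) (M : choiceType).
Variables (e : M) (op : M -> M -> M) (act : M -> R -> R).

Fact smul_key : unit. Proof. by []. Qed.
Definition smul := locked_with smul_key (fun g h : {malg R[M]} =>
  mlin (fun m x => mlin (fun n y => << x * act m y *g op m n >>) h) g
    : {malg R[M]}).
Definition sone : {malg R[M]} := mkmalgU e 1.
Definition sscale := locked_with smul_key (fun (c : k) (g : {malg R[M]}) =>
  mlin (fun m x => << c *:k x *g m >>) g : {malg R[M]}).

Hypothesis opA : associative op.
Hypothesis op1 : left_id e op.
Hypothesis opr1 : right_id e op.
Hypothesis act_mor : forall m, alg_morphism (act m).
Hypothesis act1 : forall x, act e x = x.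
Hypothesis actM : forall m n x, act (op m n) x = act m (act n x).

Let f2 m x n y : {malg R[M]} := << x * act m y *g op m n >>.

Let f2D m x n : {morph f2 m x n : y z / y + z}.
Proof. by move=> y z; rewrite /f2 (act_mor m).1.1 mulrDr monalgUD. Qed.

Let f1D h m : {morph (fun x => mlin (f2 m x) h) : y z / y + z}.
Proof.
move=> y z; rewrite /mlin -big_split; apply: eq_bigr => n _.
by rewrite /f2 mulrDl monalgUD.
Qed.

Lemma smulDl : left_distributive smul +%R.
Proof. by move=> g g' h; rewrite /smul !locked_withE mlinD //; apply: f1D. Qed.

Lemma smulDr : right_distributive smul +%R.
Proof.
move=> g h h'; rewrite /smul !locked_withE /mlin -big_split; apply: eq_bigr => m _.
exact: (mlinD (@f2D m _) h h').
Qed.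

Lemma smulUU m x n y : smul << x *g m >> << y *g n >> = << x * act m y *g op m n >>.
Proof. by rewrite /smul !locked_withE mlinU; [rewrite mlinU //; apply: f2D | apply: f1D]. Qed.

Lemma smul0l h : smul 0 h = 0.
Proof. by rewrite ?/smul ?/sscale !locked_withE mlin0. Qed.

Lemma smul0r h : smul h 0 = 0.
Proof. by rewrite /smul !locked_withE /mlin big1 // => m _; rewrite msupp0 big_seq_fset0. Qed.

Lemma smulA : associative smul.
Proof.
move=> g h l; elim/malg_ind: g => [|m x|g g' Hg Hg'].
- by rewrite !smul0l.
- elim/malg_ind: h => [|n y|h h' Hh Hh']; last by rewrite !(smulDl,smulDr) Hh Hh'.
    by rewrite !(smul0r,smul0l).
  elim/malg_ind: l => [|p z|l l' Hl Hl']; last by rewrite !smulDr Hl Hl'.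
    by rewrite !smul0r.
  by rewrite !smulUU opA actM (act_mor m).2.2 mulrA.
- by rewrite !smulDl Hg Hg'.
Qed.

Lemma smul1 : left_id sone smul.
Proof.
elim/malg_ind => [|n y|h h' Hh Hh']; rewrite ?smul0r ?smulDr ?Hh ?Hh' //.
by rewrite smulUU act1 op1 mul1r.
Qed.

Lemma smulr1 : right_id sone smul.
Proof.
elim/malg_ind => [|n y|h h' Hh Hh']; rewrite ?smul0l ?smulDl ?Hh ?Hh' //.
by rewrite smulUU (act_mor n).2.1 opr1 mulr1.
Qed.

Let scD c m : {morph (fun x => << c *:k x *g m >> : {malg R[M]}) : y z / y + z}.
Proof. by move=> x y; rewrite pzscaleDr monalgUD. Qed.

Lemma sscaleDr c g h : sscale c (g + h) = sscale c g + sscale c h.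
Proof. by rewrite /sscale !locked_withE mlinD. Qed.

Lemma sscaleU c m x : sscale c << x *g m >> = << c *:k x *g m >>.
Proof. by rewrite /sscale !locked_withE mlinU. Qed.

Lemma sscale0 c : sscale c 0 = 0.
Proof. by rewrite ?/smul ?/sscale !locked_withE mlin0. Qed.

Lemma sscaleA c d g : sscale c (sscale d g) = sscale (c * d) g.
Proof.
elim/malg_ind: g => [|m x|g h Hg Hh]; rewrite ?sscale0 // ?sscaleU ?pzscaleA //.
by rewrite !sscaleDr Hg Hh.
Qed.

Lemma sscale1 g : sscale 1 g = g.
Proof.
elim/malg_ind: g => [|m x|g h Hg Hh]; rewrite ?sscale0 // ?sscaleU ?pzscale1 //.
by rewrite !sscaleDr Hg Hh.
Qed.

Lemma sscaleDl g c d : sscale (c + d) g = sscale c g + sscale d g.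
Proof.
elim/malg_ind: g => [|m x|g h Hg Hh].
- by rewrite !sscale0 addr0.
- by rewrite !sscaleU pzscaleDl monalgUD.
- by rewrite !sscaleDr Hg Hh addrACA.
Qed.

Lemma sscaleAl c g h : sscale c (smul g h) = smul (sscale c g) h.
Proof.
elim/malg_ind: g => [|m x|g g' Hg Hg'].
- by rewrite ?(smul0l, sscale0).
- elim/malg_ind: h => [|n y|h h' Hh Hh'].
  + by rewrite ?(smul0r, sscale0).
  + by rewrite smulUU !sscaleU smulUU pzscaleAl.
  + by rewrite !(smulDr, sscaleDr) Hh Hh'.
- by rewrite !(smulDl, sscaleDr) Hg Hg'.
Qed.

Lemma sscaleAr c g h : sscale c (smul g h) = smul g (sscale c h).
Proof.
elim/malg_ind: g => [|m x|g g' Hg Hg'].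
- by rewrite ?(smul0l, sscale0).
- elim/malg_ind: h => [|n y|h h' Hh Hh'].
  + by rewrite ?(smul0r, sscale0).
  + by rewrite smulUU !sscaleU smulUU pzscaleAr (act_mor m).1.2.
  + by rewrite !(smulDr, sscaleDr) Hh Hh'.
- by rewrite !(smulDl, sscaleDr) Hg Hg'.
Qed.

End SkewMonoidAlgebra.

Section TensorProduct.
Variables (k : comPzRingType) (A C : pzAlgType k).

(* The free k-module on A x C with (a, c)(a', c') = (a a', c c'). *)
Definition pretens := {malg (k^o)%type[(A * C)%type]}.
HB.instance Definition _ := GRing.Zmodule.on pretens.

Definition pair_mul (p q : A * C) := (p.1 * q.1, p.2 * q.2).
Definition triv_act (_ : A * C) (x : k^o) := x.

Lemma pair_mulA : associative pair_mul.
Proof. by move=> p q t; rewrite /pair_mul /= !mulrA. Qed.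
Lemma pair_mul1 : left_id (1, 1) pair_mul.
Proof. by move=> [a c]; rewrite /pair_mul /= !mul1r. Qed.
Lemma pair_mulr1 : right_id (1, 1) pair_mul.
Proof. by move=> [a c]; rewrite /pair_mul /= !mulr1. Qed.
Lemma triv_act_mor p : alg_morphism (triv_act p).
Proof. by []. Qed.

HB.instance Definition _ := GRing.Zmodule_isPzRing.Build pretens
  (smulA pair_mulA triv_act_mor (fun _ _ _ => erefl))
  (smul1 pair_mul1 triv_act_mor (fun _ => erefl))
  (smulr1 pair_mulr1 triv_act_mor)
  (smulDl pair_mul triv_act)
  (smulDr pair_mul triv_act_mor).
HB.instance Definition _ := isPzAlgebra.Build k pretens
  (@sscaleA _ _ _) (@sscale1 _ _ _) (@sscaleDr _ _ _) (@sscaleDl _ _ _)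
  (sscaleAl pair_mul triv_act_mor) (sscaleAr pair_mul triv_act_mor).

Definition pret (a : A) (c : C) : pretens := << 1 *g (a, c) >>.

(* tens is the tensor product over k: the span of the bilinearity relators is
   already an ideal of pretens. *)
Inductive tens_rel : pretens -> Prop :=
| tens_relDl a a' c : tens_rel (pret (a + a') c - pret a c - pret a' c)
| tens_relDr a c c' : tens_rel (pret a (c + c') - pret a c - pret a c')
| tens_relZl x a c : tens_rel (pret (x *:k a) c - x *:k pret a c)
| tens_relZr x a c : tens_rel (pret a (x *:k c) - x *:k pret a c).

Definition tens := quot_alg tens_rel.
HB.instance Definition _ := PzAlgebra.on tens.

Fact tens_key : unit. Proof. by []. Qed.
Definition tmk := locked_with tens_key
  (fun (a : A) (c : C) => qpi tens_rel (pret a c) : tens).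

Lemma tmkE a c : tmk a c = qpi tens_rel (pret a c).
Proof. by rewrite /tmk locked_withE. Qed.

End TensorProduct.

Section TensorTheory.
Variables (k : comPzRingType) (A C : pzAlgType k).

Definition bilinear_map (D : pzAlgType k) (f : A -> C -> D) :=
  (forall c, klinear (f^~ c)) /\ (forall a, klinear (f a)).

Lemma pretZE (x : k) (p : A * C) :
  (<< (x : k^o) *g p >> : pretens A C) = x *:k pret p.1 p.2.
Proof.
case: p => a c; rewrite /pret.
by rewrite /pzscale /= sscaleU /pzscale /= mulr1.
Qed.

Lemma pret_ind (P : pretens A C -> Prop) :
  P 0 -> (forall (x : k) a c, P (x *:k pret a c)) ->
  (forall g h, P g -> P h -> P (g + h)) -> forall g, P g.
Proof.
move=> P0 PU PD g; elim/malg_ind: g => [|p x|g h]; [exact: P0 | | exact: PD].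
by rewrite pretZE; apply: PU.
Qed.

Lemma tmk_bilinear : bilinear_map (@tmk k A C).
Proof.
have L := qpi_lin (@tens_rel k A C).
split=> [c|a]; split=> [x y|x y]; rewrite !tmkE.
- apply: etrans (L.1 _ _); apply: qpi_rel.
  by rewrite opprD addrA; apply: tens_relDl.
- by apply: etrans (L.2 _ _); apply: qpi_rel; apply: tens_relZl.
- apply: etrans (L.1 _ _); apply: qpi_rel.
  by rewrite opprD addrA; apply: tens_relDr.
- by apply: etrans (L.2 _ _); apply: qpi_rel; apply: tens_relZr.
Qed.

Lemma tmkM (a a' : A) (c c' : C) : tmk a c * tmk a' c' = tmk (a * a') (c * c').
Proof.
rewrite !tmkE -(qpi_mor (@tens_rel k A C)).2.2; congr qpi.
rewrite /pret [LHS](smulUU _ (@triv_act_mor k A C)).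
by rewrite /triv_act mul1r.
Qed.

Lemma tmk1 : tmk (1 : A) (1 : C) = 1.
Proof. by rewrite tmkE. Qed.

Lemma tens_span (t : tens A C) :
  span (fun z => exists a c, z = tmk a c) t.
Proof.
rewrite -(qpiK t); elim/pret_ind: (repr t) => [|x a c|g h Hg Hh].
- by rewrite (klin0 (qpi_lin _)); apply: span0.
- by rewrite (qpi_lin _).2; apply/spanZ/span_mem; exists a, c; rewrite tmkE.
- by rewrite (qpi_lin _).1; apply: spanD.
Qed.

Definition tens_lift (D : pzAlgType k) (f : A -> C -> D) (t : tens A C) : D :=
  mlin (fun p (x : k^o) => (x : k) *:k f p.1 p.2) (repr t).

Section Lift.
Variables (D : pzAlgType k) (f : A -> C -> D).
Hypothesis fB : bilinear_map f.

Let pl (g : pretens A C) : D := mlin (fun p (x : k^o) => (x : k) *:k f p.1 p.2) g.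

Let pl_lin : klinear pl.
Proof.
have fD p : {morph (fun x : k^o => (x : k) *:k f p.1 p.2) : y z / y + z}.
  by move=> y z; rewrite pzscaleDl.
split=> [g h|c g]; first by rewrite /pl mlinD.
rewrite /pl; elim/malg_ind: g => [|p x|g h Hg Hh].
- by rewrite pzscaler0 mlin0 // pzscaler0.
- rewrite [c *:k _]sscaleU !mlinU //.
  by rewrite pzscaleA.
- by rewrite pzscaleDr !mlinD // Hg Hh pzscaleDr.
Qed.

Let plU a c : pl (pret a c) = f a c.
Proof.
by rewrite /pl mlinU ?pzscale1 // => p y z; rewrite pzscaleDl.
Qed.

Let pretM a c a' c' : pret a c * pret a' c' = pret (a * a') (c * c') :> pretens A C.
Proof.
by rewrite /pret [LHS](smulUU _ (@triv_act_mor k A C)) /triv_act mul1r.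
Qed.

Let pl_rel (T : pretens A C -> D) (h : A -> C -> D) z :
  klinear T -> bilinear_map h -> (forall a c, T (pret a c) = h a c) ->
  tens_rel z -> T z = 0.
Proof.
move=> TL hB Th; case=> [a a' e|a e e'|x a e|x a e].
- rewrite (klinB _ _ TL) (klinB _ _ TL) !Th (hB.1 _).1.
  by rewrite -addrA -opprD subrr.
- rewrite (klinB _ _ TL) (klinB _ _ TL) !Th (hB.2 _).1.
  by rewrite -addrA -opprD subrr.
- by rewrite (klinB _ _ TL) TL.2 !Th (hB.1 _).2 subrr.
- by rewrite (klinB _ _ TL) TL.2 !Th (hB.2 _).2 subrr.
Qed.

Let pl0 i : ideal_gen (@tens_rel k A C) i -> pl i = 0.
Proof.
apply: (span_eq0 pl_lin) => _ [x [z [y [zr ->]]]].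
elim/pret_ind: x => [|c a0 c0|g h Hg Hh]; last 1 first.
- by rewrite !mulrDl pl_lin.1 Hg Hh addr0.
- by rewrite !mul0r (klin0 pl_lin).
elim/pret_ind: y => [|d a1 c1|g h Hg Hh]; last 1 first.
- by rewrite mulrDr pl_lin.1 Hg Hh addr0.
- by rewrite mulr0 (klin0 pl_lin).
rewrite -pzscaleAl -pzscaleAl -pzscaleAr pl_lin.2 pl_lin.2.
suff -> : pl (pret a0 c0 * z * pret a1 c1) = 0 by rewrite !pzscaler0.
pose T t := pl (pret a0 c0 * t * pret a1 c1).
apply: (pl_rel (T := T) (h := fun a e => f (a0 * a * a1) (c0 * e * c1))) zr.
- split=> [t t'|b t]; rewrite /T; first by rewrite mulrDr mulrDl pl_lin.1.
  by rewrite -pzscaleAr -pzscaleAl pl_lin.2.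
- split=> [e|a]; split=> [t t'|b t].
  + by rewrite mulrDr mulrDl (fB.1 _).1.
  + by rewrite -pzscaleAr -pzscaleAl (fB.1 _).2.
  + by rewrite mulrDr mulrDl (fB.2 _).1.
  + by rewrite -pzscaleAr -pzscaleAl (fB.2 _).2.
- by move=> a e; rewrite /T pretM pretM plU.
Qed.

Lemma tens_lift_qpi g : tens_lift f (qpi _ g) = pl g.
Proof.
rewrite /tens_lift -/(pl _).
by apply/eqP; rewrite -subr_eq0 -(klinB _ _ pl_lin) pl0 //; apply: repr_qpi.
Qed.

Lemma tens_liftE a c : tens_lift f (tmk a c) = f a c.
Proof. by rewrite tmkE tens_lift_qpi plU. Qed.

Lemma tens_lift_lin : klinear (tens_lift f).
Proof.
have L := qpi_lin (@tens_rel k A C).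
split=> [u w|c u].
  rewrite -(qpiK u) -(qpiK w) -[X in tens_lift f X](L.1 (repr u) (repr w)).
  by rewrite !tens_lift_qpi pl_lin.1.
rewrite -(qpiK u) -[X in tens_lift f X](L.2 c (repr u)).
by rewrite !tens_lift_qpi pl_lin.2.
Qed.

End Lift.

Lemma bilinear_comp (A' C' : pzAlgType k) (f : A' -> A) (g : C' -> C) :
  klinear f -> klinear g ->
  (forall c, klinear (fun a => tmk (f a) (g c))) /\
  (forall a, klinear (fun c => tmk (f a) (g c))).
Proof.
move=> fL gL; split=> [c|a].
  exact: klin_comp (tmk_bilinear.1 (g c)) fL.
exact: klin_comp (tmk_bilinear.2 (f a)) gL.
Qed.

End TensorTheory.

Record gammaAlg (k : fieldType) (G : groupType) := GammaAlg {
  ga_sort :> comPzAlgType k;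
  act : G -> ga_sort -> ga_sort;
  act_mor : forall g, alg_morphism (act g);
  act1 : forall b, act 1%g b = b;
  actM : forall g h b, act (g * h)%g b = act g (act h b)
}.

Section DynamicalAlgebras.
Variables (k : fieldType) (G : groupType) (B : gammaAlg k G).

(* bg_deg g g' is the homogeneous component A_{g,g'}. *)
Record bgalg := BGAlg {
  bg_sort :> pzAlgType k;
  bg_deg : G -> G -> bg_sort -> Prop;
  bg_r : B -> bg_sort;
  bg_s : B -> bg_sort;
  bg_deg0 : forall g g', bg_deg g g' 0;
  bg_degD : forall g g' x y,
    bg_deg g g' x -> bg_deg g g' y -> bg_deg g g' (x + y);
  bg_degZ : forall g g' c x, bg_deg g g' x -> bg_deg g g' (c *:k x);
  bg_deg_span : forall x, span (fun y => exists g g', bg_deg g g' y) x;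
  bg_deg_indep : forall (ds : seq (G * G)) (x : G * G -> bg_sort),
    uniq ds -> (forall d, bg_deg d.1 d.2 (x d)) -> \sum_(d <- ds) x d = 0 ->
    forall d, d \in ds -> x d = 0;
  bg_degM : forall g g' h h' x y,
    bg_deg g g' x -> bg_deg h h' y -> bg_deg (g * h)%g (g' * h')%g (x * y);
  bg_r_mor : alg_morphism bg_r;
  bg_s_mor : alg_morphism bg_s;
  bg_r_deg : forall b, bg_deg 1%g 1%g (bg_r b);
  bg_s_deg : forall b, bg_deg 1%g 1%g (bg_s b);
  bg_rs : forall b b', bg_r b * bg_s b' = bg_s b' * bg_r b;
  bg_rC : forall g g' a b, bg_deg g g' a -> a * bg_r b = bg_r (act g b) * a;
  bg_sC : forall g g' a b, bg_deg g g' a -> a * bg_s b = bg_s (act g' b) * a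
}.

Record bgmorphism (A C : bgalg) (f : A -> C) : Prop := BGMorphism {
  bgm_alg : alg_morphism f;
  bgm_deg : forall g g' a, bg_deg g g' a -> bg_deg g g' (f a);
  bgm_r : forall b, f (bg_r A b) = bg_r C b;
  bgm_s : forall b, f (bg_s A b) = bg_s C b
}.

End DynamicalAlgebras.
Section DegreeProjections.
Variables (k : fieldType) (G : groupType) (B : gammaAlg k G) (A : bgalg B).
Variable D : G * G -> bool.

Let T := ((G * G) * A)%type.

Let rel (a y : A) := exists L : seq T,
  [/\ forall t, t \in L -> bg_deg t.1.1 t.1.2 t.2,
      a = \sum_(t <- L) t.2 & y = \sum_(t <- L | D t.1) t.2].

Let rel0 y : rel 0 y -> y = 0.
Proof.
case=> L [Ldeg L0 ->].
pose ds := undup (map fst L); pose x d := \sum_(t <- L | t.1 == d) t.2.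
have xdeg d : bg_deg d.1 d.2 (x d).
  rewrite /x big_seq_cond; apply: big_ind => [|u w|t /andP[/Ldeg td /eqP <-]] //.
    exact: bg_deg0.
  exact: bg_degD.
have sumE (Q : pred (G * G)) :
    \sum_(d <- ds | Q d) x d = \sum_(t <- L | Q t.1) t.2.
  rewrite /x (exchange_big_dep (fun t => Q t.1)) /=; last first.
    by move=> d t Qd /eqP ->.
  rewrite big_seq_cond [RHS]big_seq_cond; apply: eq_bigr => t /andP[tL Qt].
  rewrite big_mkcond (bigD1_seq t.1) ?undup_uniq ?mem_undup ?map_f //=.
  rewrite Qt eqxx /= big1 ?addr0 // => d; rewrite eq_sym => /negbTE ->.
  by rewrite andbF.
rewrite -sumE big_seq_cond big1 // => d /andP[dds _].
apply: (bg_deg_indep (undup_uniq (map fst L)) xdeg) => //.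
by rewrite (sumE xpredT) -L0.
Qed.

Let relL c a y a' y' : rel a y -> rel a' y' -> rel (c *:k a + a') (c *:k y + y').
Proof.
case=> L [Ld -> ->] [L' [Ld' -> ->]].
exists (map (fun t => (t.1, c *:k t.2)) L ++ L'); split.
- move=> t; rewrite mem_cat => /orP[/mapP[u /Ld ud ->]|/Ld'] //=.
  exact: bg_degZ.
- by rewrite big_cat big_map /= pzscale_sumr.
- by rewrite big_cat big_map /= pzscale_sumr.
Qed.

Let rel_fun a y y' : rel a y -> rel a y' -> y = y'.
Proof.
move=> ay ay'; apply/eqP; rewrite -subr_eq0; apply/eqP/rel0.
have := relL (-1) ay' ay; rewrite !pzscaleN1 addNr.
by rewrite addrC.
Qed.

Let rel_deg g g' a : bg_deg g g' a -> rel a (if D (g, g') then a else 0).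
Proof.
move=> ad; exists [:: ((g, g'), a)]; split=> [t||].
- by rewrite inE => /eqP ->.
- by rewrite big_seq1.
- by rewrite big_cons big_nil /= addr0.
Qed.

Let rel_ex a : exists y, rel a y.
Proof.
elim: (bg_deg_span a) => [|c x y [g [g' xd]] _ [z zy]].
  by exists 0, [::]; rewrite !big_nil.
by exists (c *:k (if D (g, g') then x else 0) + z); apply/relL/zy/rel_deg.
Qed.

Lemma deg_proj_ex : exists f : A -> A, klinear f /\
  forall g g' a, bg_deg g g' a -> f a = if D (g, g') then a else 0.
Proof.
have [f fP] := choice rel_ex; exists f; split; last first.
  by move=> g g' a /rel_deg; apply: rel_fun.
have r0 : rel 0 0 by exists [::]; rewrite !big_nil.
split=> [x y|c x]; apply: rel_fun (fP _) _.
  by have := relL 1 (fP x) (fP y); rewrite !pzscale1.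
by have := relL c (fP x) r0; rewrite !addr0.
Qed.

End DegreeProjections.

Section FiberProduct.
Variables (k : fieldType) (G : groupType) (B : gammaAlg k G).
Variables A C : bgalg B.

Definition outer_matched g g'' (t : tens A C) := exists g' a c,
  [/\ bg_deg g g' a, bg_deg g' g'' c & t = tmk a c].

Definition matched (t : tens A C) := exists g g'', outer_matched g g'' t.

Lemma matchedM t u : matched t -> matched u -> matched (t * u).
Proof.
case=> [g [g'' [g' [a [c [ad cd ->]]]]]] [h [h'' [h' [a' [c' [ad' cd' ->]]]]]].
exists (g * h)%g, (g'' * h'')%g, (g' * h')%g, (a * a'), (c * c').
by rewrite tmkM; split=> //; apply: bg_degM.
Qed.

Lemma bg_deg1 (D : bgalg B) : bg_deg 1%g 1%g (1 : D).
Proof. by rewrite -(bg_r_mor D).2.1; apply: bg_r_deg. Qed.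

Lemma matched1 : matched 1.
Proof. by exists 1%g, 1%g, 1%g, 1, 1; rewrite tmk1; split=> //; apply: bg_deg1. Qed.

Definition fiber_sub : subalgebra (tens A C) :=
  @Subalgebra _ _ (span matched) (span_mem matched1) (@spanB _ _ _)
    (fun x y => @span_mul _ _ _ _ _ x y
       (fun t u tm um => span_mem (matchedM tm um)))
    (@spanZ _ _ _).

Lemma fiber_subE t : span matched t -> sub_val (sub_in fiber_sub t) = t.
Proof. exact: (@sub_inE _ _ fiber_sub). Qed.

Definition fiber_rel (z : sub_alg fiber_sub) : Prop := exists b,
  sub_val z = tmk (bg_s A b) 1 - tmk 1 (bg_r C b).

Definition fiber_alg := quot_alg fiber_rel.
HB.instance Definition _ := PzAlgebra.on fiber_alg.

Fact fiber_key : unit. Proof. by []. Qed.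
Definition fcls := locked_with fiber_key
  (fun t : tens A C => qpi fiber_rel (sub_in fiber_sub t) : fiber_alg).

Lemma fclsE t : fcls t = qpi fiber_rel (sub_in fiber_sub t).
Proof. by rewrite /fcls locked_withE. Qed.

(* Only meaningful when a \in A_{g,g'} and c \in C_{g',g''} for some
   g, g', g''. *)
Definition ftens (a : A) (c : C) : fiber_alg := fcls (tmk a c).

Definition fiber_deg g g'' : fiber_alg -> Prop :=
  span (fun u => exists g' a c,
    [/\ bg_deg g g' a, bg_deg g' g'' c & u = ftens a c]).

Definition fiber_r b := ftens (bg_r A b) 1.
Definition fiber_s b := ftens 1 (bg_s C b).

Definition outer_rel g g'' (t : tens A C) := exists g' a c b,
  [/\ bg_deg g g' a, bg_deg g' g'' c &
      t = tmk (bg_s A b * a) c - tmk a (bg_r C b * c)].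

Definition inner_rel t := exists g g'', outer_rel g g'' t.

Let tL a : klinear (tmk a : C -> tens A C) := (tmk_bilinear A C).2 a.
Let tR c : klinear (fun a : A => tmk a c : tens A C) := (tmk_bilinear A C).1 c.

Lemma deg_smul g g' (a : A) b : bg_deg g g' a -> bg_deg g g' (bg_s A b * a).
Proof.
by move=> ad; rewrite -[g]mul1g -[g']mul1g; apply: bg_degM => //; apply: bg_s_deg.
Qed.

Lemma deg_rmul g g' (c : C) b : bg_deg g g' c -> bg_deg g g' (bg_r C b * c).
Proof.
by move=> cd; rewrite -[g]mul1g -[g']mul1g; apply: bg_degM => //; apply: bg_r_deg.
Qed.

Lemma ideal_inner z : ideal_gen fiber_rel z -> span inner_rel (sub_val z).
Proof.
apply: (span_mor (f := @sub_val _ _ fiber_sub)); first exact: sub_val_lin.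
move=> _ [x [z' [y [[b zb] ->]]]].
rewrite [sub_val _](_ : _ = sub_val x * sub_val z' * sub_val y) // zb.
have: span inner_rel (sub_val x * (tmk (bg_s A b) 1 - tmk 1 (bg_r C b))).
  apply: (span_mor (f := fun u => u * (tmk (bg_s A b) 1 - tmk 1 (bg_r C b))))
    (sub_mem x).
    by split=> [u w|c u]; rewrite ?mulrDl ?pzscaleAl.
  move=> _ [g [g'' [g' [a [c [ad cd ->]]]]]].
  rewrite mulrBr !tmkM !mulr1 (bg_sC _ ad) (bg_rC _ cd).
  by apply: span_mem; exists g, g'', g', a, c, (act g' b).
move=> xz; apply: span_mul xz (sub_mem y).
move=> _ _ [g [g'' [g' [a [c [e [ad cd ->]]]]]]]
  [h [h'' [h' [a' [c' [ad' cd' ->]]]]]].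
rewrite mulrBl !tmkM -!mulrA; apply: span_mem.
exists (g * h)%g, (g'' * h'')%g, (g' * h')%g, (a * a'), (c * c'), e.
by split=> //; apply: bg_degM.
Qed.

Lemma inner_ideal z : span inner_rel (sub_val z) -> ideal_gen fiber_rel z.
Proof.
have key t : span inner_rel t ->
    exists2 w, sub_val w = t & ideal_gen fiber_rel w.
  elim=> [|x u t' [g [g'' [g' [a [c [b [ad cd ->]]]]]]] _ [w <- wi]].
    by exists 0 => //; apply: span0.
  have m1 : span matched (tmk (bg_s A b) 1).
    by apply: span_mem; exists 1%g, 1%g, 1%g, (bg_s A b), 1; split=> //;
      [apply: bg_s_deg | apply: bg_deg1].
  have m2 : span matched (tmk 1 (bg_r C b)).
    by apply: span_mem; exists 1%g, 1%g, 1%g, 1, (bg_r C b); split=> //;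
      [apply: bg_deg1 | apply: bg_r_deg].
  have mac : span matched (tmk a c).
    by apply: span_mem; exists g, g'', g', a, c.
  pose z1 := sub_in fiber_sub (tmk (bg_s A b) 1 - tmk 1 (bg_r C b)).
  have z1E : sub_val z1 = tmk (bg_s A b) 1 - tmk 1 (bg_r C b).
    by apply: sub_inE; apply: spanB.
  pose z2 := sub_in fiber_sub (tmk a c).
  have z2E : sub_val z2 = tmk a c by apply: sub_inE.
  exists (x *:k (1 * z1 * z2) + w); last first.
    by apply: spanS => //; exists 1, z1, z2; split=> //; exists b.
  rewrite mul1r (sub_val_lin _).1 (sub_val_lin _).2 (sub_val_mor _).2.2 z1E z2E.
  by rewrite mulrBl !tmkM !mul1r.
by move=> /key [w wz]; rewrite (val_inj wz).
Qed.

Lemma fcls0 t : span inner_rel t -> fcls t = 0.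
Proof.
move=> ti; apply/eqP; rewrite !fclsE; apply/eqP.
have tm : fiber_sub t.
  apply: span_sub ti => _ [g [g'' [g' [a [c [b [ad cd ->]]]]]]].
  apply: spanB; apply: span_mem.
    by exists g, g'', g', (bg_s A b * a), c; split=> //; apply: deg_smul.
  by exists g, g'', g', a, (bg_r C b * c); split=> //; apply: deg_rmul.
rewrite -[0 in RHS](klin0 (qpi_lin fiber_rel)); apply/qpiE; rewrite subr0.
by apply: inner_ideal; rewrite sub_inE.
Qed.

Lemma fclsD t u : span matched t -> span matched u ->
  fcls (t + u) = fcls t + fcls u.
Proof.
move=> tm um; rewrite !fclsE -(qpi_lin fiber_rel).1; congr qpi.
by apply: val_inj; rewrite /= !sub_inE //; apply: spanD.
Qed.

Lemma fclsZ c t : span matched t -> fcls (c *:k t) = c *:k fcls t.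
Proof.
move=> tm; rewrite !fclsE -(qpi_lin fiber_rel).2; congr qpi.
by apply: val_inj; rewrite /= !sub_inE //; apply: spanZ.
Qed.

Lemma fclsM t u : span matched t -> span matched u ->
  fcls (t * u) = fcls t * fcls u.
Proof.
move=> tm um; rewrite !fclsE -(qpi_mor fiber_rel).2.2; congr qpi.
by apply: val_inj; rewrite /= !sub_inE //; apply: (@sa_memM _ _ fiber_sub).
Qed.

Lemma fcls_surj u : exists2 t, span matched t & u = fcls t.
Proof.
exists (sub_val (repr u)); first exact: (sub_mem (repr u)).
by rewrite !fclsE sub_valK qpiK.
Qed.

Lemma outer_span g g'' t : span (outer_matched g g'') t -> span matched t.
Proof. by apply: span_sub => y ym; apply: span_mem; exists g, g''. Qed.

Lemma tmk_matched g g' g'' a c :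
  bg_deg g g' a -> bg_deg g' g'' c -> span matched (tmk a c).
Proof. by move=> ad cd; apply: span_mem; exists g, g'', g', a, c. Qed.

Lemma ftensM g g' g'' h h' h'' a c a' c' :
  bg_deg g g' a -> bg_deg g' g'' c -> bg_deg h h' a' -> bg_deg h' h'' c' ->
  ftens a c * ftens a' c' = ftens (a * a') (c * c').
Proof.
move=> ad cd ad' cd'; rewrite /ftens -fclsM ?tmkM //.
  exact: tmk_matched ad cd.
exact: tmk_matched ad' cd'.
Qed.

Lemma ftens_deg g g' g'' a c :
  bg_deg g g' a -> bg_deg g' g'' c -> fiber_deg g g'' (ftens a c).
Proof. by move=> ad cd; apply: span_mem; exists g', a, c. Qed.

Lemma ftens_balanced g g' g'' a c b :
  bg_deg g g' a -> bg_deg g' g'' c ->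
  ftens (bg_s A b * a) c = ftens a (bg_r C b * c).
Proof.
move=> ad cd; apply/eqP; rewrite -subr_eq0; apply/eqP.
have m1 := tmk_matched (deg_smul b ad) cd.
have m2 := tmk_matched ad (deg_rmul b cd).
rewrite /ftens -pzscaleN1 -fclsZ // -fclsD //; last exact: spanZ.
rewrite pzscaleN1; apply/fcls0/span_mem.
by exists g, g'', g', a, c, b.
Qed.

Lemma fiber_degP g g'' u :
  fiber_deg g g'' u -> exists2 t, span (outer_matched g g'') t & u = fcls t.
Proof.
elim=> [|x y z [g' [a [c [ad cd ->]]]] _ [t tm ->]].
  by exists 0; [apply: span0 | rewrite fcls0 //; apply: span0].
exists (x *:k tmk a c + t); first by apply: spanS => //; exists g', a, c.
have mac := tmk_matched ad cd.
by rewrite fclsD ?fclsZ //; [apply: spanZ | apply: outer_span tm].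
Qed.

Lemma fiber_deg0 g g' : fiber_deg g g' 0.
Proof. exact: span0. Qed.

Lemma fiber_degD g g' x y :
  fiber_deg g g' x -> fiber_deg g g' y -> fiber_deg g g' (x + y).
Proof. exact: spanD. Qed.

Lemma fiber_degZ g g' c x : fiber_deg g g' x -> fiber_deg g g' (c *:k x).
Proof. exact: spanZ. Qed.

Lemma fiber_ind (P : fiber_alg -> Prop) :
  P 0 -> (forall u w, P u -> P w -> P (u + w)) ->
  (forall x u, P u -> P (x *:k u)) ->
  (forall g g' g'' a c, bg_deg g g' a -> bg_deg g' g'' c -> P (ftens a c)) ->
  forall u, P u.
Proof.
move=> P0 PD PZ PT u; have [t tm ->] := fcls_surj u.
suff []: span matched t /\ P (fcls t) by [].
elim: tm => [|x y z [g [g'' [g' [a [c [ad cd ->]]]]]] _ [zm Pz]].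
  by split; [apply: span0 | rewrite fcls0 //; apply: span0].
have mac := tmk_matched ad cd.
split; first by apply: spanD => //; apply: spanZ.
rewrite fclsD ?fclsZ //; last exact: spanZ.
by apply/PD/Pz/PZ/(PT _ _ _ _ _ ad cd).
Qed.

Lemma fiber_deg_span x : span (fun y => exists g g', fiber_deg g g' y) x.
Proof.
elim/fiber_ind: x => [|u w|c u|g g' g'' a c ad cd].
- exact: span0.
- exact: spanD.
- exact: spanZ.
- by apply: span_mem; exists g, g''; apply: ftens_deg ad cd.
Qed.

Lemma outer_proj d : exists f : tens A C -> tens A C, klinear f /\
  forall g g'' g' a c, bg_deg g g' a -> bg_deg g' g'' c ->
    f (tmk a c) = if (g, g'') == d then tmk a c else 0.
Proof.
have [p [pL pE]] := @deg_proj_ex k G B A (fun e => e.1 == d.1).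
have [q [qL qE]] := @deg_proj_ex k G B C (fun e => e.2 == d.2).
have fB := bilinear_comp pL qL.
exists (tens_lift (fun a c => tmk (p a) (q c))); split.
  exact: tens_lift_lin fB.
move=> g g'' g' a c ad cd; rewrite (tens_liftE fB) (pE _ _ _ ad) (qE _ _ _ cd).
rewrite -pair_eqE /pair_eq /=; do 2 case: eqP => //= _.
- exact: klin0 (tL _).
- exact: klin0 (tR _).
- exact: klin0 (tR _).
Qed.

Lemma fiber_deg_indep (ds : seq (G * G)) (x : G * G -> fiber_alg) :
  uniq ds -> (forall d, fiber_deg d.1 d.2 (x d)) -> \sum_(d <- ds) x d = 0 ->
  forall d, d \in ds -> x d = 0.
Proof.
move=> ds_uniq xdeg x0 d dds.
have /choice [y yP] : forall e, exists t,
    span (outer_matched e.1 e.2) t /\ x e = fcls t.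
  by move=> e; have [t tm xt] := fiber_degP (xdeg e); exists t.
have ym e : span matched (y e) := outer_span (yP e).1.
have sumE (s : seq (G * G)) : span matched (\sum_(e <- s) y e) /\
    \sum_(e <- s) x e = fcls (\sum_(e <- s) y e).
  elim: s => [|e s [IH1 IH2]].
    by rewrite !big_nil fcls0; [split; first exact: span0 | exact: span0].
  rewrite !big_cons IH2 (yP e).2 fclsD //.
  by split=> //; apply: spanD.
have [sm sE] := sumE ds.
have Y0 : span inner_rel (\sum_(e <- ds) y e).
  rewrite -(fiber_subE sm); apply: ideal_inner.
  rewrite -[sub_in _ _]subr0; apply/qpiE.
  by rewrite -fclsE -sE x0; apply: esym; apply: (klin0 (qpi_lin _)).
have [p [pL pE]] := outer_proj d.
have py e : p (y e) = if e == d then y e else 0.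
  have pK : klinear (fun t : tens A C => if e == d then t else 0).
    by split=> [t u|c t]; case: eqP; rewrite ?addr0 ?pzscaler0.
  apply: (span_eq pL pK) (yP e).1 => _ [g' [a [c [ad cd ->]]]].
  by rewrite (pE _ _ _ _ _ ad cd) -surjective_pairing.
have pY : p (\sum_(e <- ds) y e) = y d.
  rewrite (klin_sum _ _ _ pL) (bigD1_seq d) //= py eqxx big1 ?addr0 // => e.
  by rewrite py => /negbTE ->.
rewrite (yP d).2; apply: fcls0; rewrite -pY; apply: (span_mor pL _ Y0).
move=> _ [g [g'' [g' [a [c [b [ad cd ->]]]]]]].
rewrite (klinB _ _ pL) (pE _ _ _ _ _ (deg_smul b ad) cd).
rewrite (pE _ _ _ _ _ ad (deg_rmul b cd)).
case: eqP => _; last by rewrite subr0; apply: span0.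
by apply: span_mem; exists g, g'', g', a, c, b.
Qed.

Lemma fiber_degM g g' h h' x y :
  fiber_deg g g' x -> fiber_deg h h' y ->
  fiber_deg (g * h)%g (g' * h')%g (x * y).
Proof.
apply: span_mul => _ _ [u [a [c [ad cd ->]]]] [w [a' [c' [ad' cd' ->]]]].
rewrite (ftensM ad cd ad' cd').
by apply: ftens_deg; apply: bg_degM; eassumption.
Qed.

Let r_matched b : span matched (tmk (bg_r A b) 1).
Proof. by apply: tmk_matched (bg_r_deg _ _) (bg_deg1 _). Qed.

Let s_matched b : span matched (tmk 1 (bg_s C b)).
Proof. by apply: tmk_matched (bg_deg1 _) (bg_s_deg _ _). Qed.

Lemma fiber_r_mor : alg_morphism fiber_r.
Proof.
have rM := bg_r_mor A.
split; [split=> [x y|c x] | split=> [|x y]]; rewrite /fiber_r /ftens.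
- by rewrite rM.1.1 (tR 1).1 fclsD.
- by rewrite rM.1.2 (tR 1).2 fclsZ.
- rewrite rM.2.1 tmk1 fclsE -(qpi_mor _).2.1; congr qpi.
  by apply: val_inj; rewrite /= sub_inE //; apply/span_mem/matched1.
- by rewrite rM.2.2 -fclsM // tmkM mulr1.
Qed.

Lemma fiber_s_mor : alg_morphism fiber_s.
Proof.
have sM := bg_s_mor C.
split; [split=> [x y|c x] | split=> [|x y]]; rewrite /fiber_s /ftens.
- by rewrite sM.1.1 (tL 1).1 fclsD.
- by rewrite sM.1.2 (tL 1).2 fclsZ.
- rewrite sM.2.1 tmk1 fclsE -(qpi_mor _).2.1; congr qpi.
  by apply: val_inj; rewrite /= sub_inE //; apply/span_mem/matched1.
- by rewrite sM.2.2 -fclsM // tmkM mulr1.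
Qed.

Lemma fiber_r_deg b : fiber_deg 1%g 1%g (fiber_r b).
Proof. exact: ftens_deg (bg_r_deg _ _) (bg_deg1 _). Qed.

Lemma fiber_s_deg b : fiber_deg 1%g 1%g (fiber_s b).
Proof. exact: ftens_deg (bg_deg1 _) (bg_s_deg _ _). Qed.

Lemma fiber_rs b b' : fiber_r b * fiber_s b' = fiber_s b' * fiber_r b.
Proof.
rewrite /fiber_r /fiber_s.
rewrite (ftensM (bg_r_deg _ _) (bg_deg1 _) (bg_deg1 _) (bg_s_deg _ _)).
rewrite (ftensM (bg_deg1 _) (bg_s_deg _ _) (bg_r_deg _ _) (bg_deg1 _)).
by rewrite mul1r mulr1 mul1r mulr1.
Qed.

Lemma fiber_rC g g' a b :
  fiber_deg g g' a -> a * fiber_r b = fiber_r (act g b) * a.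
Proof.
apply: (span_eq (f := fun u => u * fiber_r b)
  (g := fun u => fiber_r (act g b) * u)).
- by split=> [u w|x u]; rewrite ?mulrDl ?pzscaleAl.
- by split=> [u w|x u]; rewrite ?mulrDr ?pzscaleAr.
move=> _ [h [x [y [xd yd ->]]]].
rewrite (ftensM xd yd (bg_r_deg _ _) (bg_deg1 _)).
rewrite (ftensM (bg_r_deg _ _) (bg_deg1 _) xd yd).
by rewrite (bg_rC _ xd) mulr1 mul1r.
Qed.

Lemma fiber_sC g g' a b :
  fiber_deg g g' a -> a * fiber_s b = fiber_s (act g' b) * a.
Proof.
apply: (span_eq (f := fun u => u * fiber_s b)
  (g := fun u => fiber_s (act g' b) * u)).
- by split=> [u w|x u]; rewrite ?mulrDl ?pzscaleAl.
- by split=> [u w|x u]; rewrite ?mulrDr ?pzscaleAr.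
move=> _ [h [x [y [xd yd ->]]]].
rewrite (ftensM xd yd (bg_deg1 _) (bg_s_deg _ _)).
rewrite (ftensM (bg_deg1 _) (bg_s_deg _ _) xd yd).
by rewrite (bg_sC _ yd) mulr1 mul1r.
Qed.

Definition fiber : bgalg B := BGAlg
  fiber_deg0 fiber_degD fiber_degZ fiber_deg_span fiber_deg_indep fiber_degM
  fiber_r_mor fiber_s_mor fiber_r_deg fiber_s_deg fiber_rs fiber_rC fiber_sC.

(* Evaluates a \tilde\otimes c |-> f a c on a representative; see fiber_liftE
   for the conditions under which this is well defined. *)
Definition fiber_lift (D : pzAlgType k) := locked_with fiber_key
  (fun (f : A -> C -> D) (u : fiber) =>
    tens_lift f (sub_val (repr (u : fiber_alg)))).

Definition balanced (D : pzAlgType k) (f : A -> C -> D) :=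
  bilinear_map f /\ forall g g' g'' a c b,
    bg_deg g g' a -> bg_deg g' g'' c -> f (bg_s A b * a) c = f a (bg_r C b * c).

Section FiberLift.
Variables (D : pzAlgType k) (f : A -> C -> D).
Hypothesis fB : balanced f.

Lemma fiber_lift_fcls t : span matched t -> fiber_lift f (fcls t) = tens_lift f t.
Proof.
move=> tm; have L := tens_lift_lin fB.1.
rewrite /fiber_lift locked_withE fclsE; apply/eqP; rewrite -subr_eq0 -(klinB _ _ L); apply/eqP.
rewrite -[X in _ - X](fiber_subE tm) -(klinB _ _ (@sub_val_lin _ _ fiber_sub)).
apply: (span_eq0 L) (ideal_inner (repr_qpi _ _)).
move=> _ [g [g'' [g' [a [c [b [ad cd ->]]]]]]].
rewrite (klinB _ _ L) !(tens_liftE fB.1); apply/eqP; rewrite subr_eq0.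
by apply/eqP/(fB.2 _ _ _ _ _ _ ad cd).
Qed.

Lemma fiber_liftE g g' g'' a c : bg_deg g g' a -> bg_deg g' g'' c ->
  fiber_lift f (ftens a c) = f a c.
Proof.
move=> ad cd; rewrite fiber_lift_fcls ?(tens_liftE fB.1) //.
exact: tmk_matched ad cd.
Qed.

Lemma fiber_lift_lin : klinear (fiber_lift f).
Proof.
have L := tens_lift_lin fB.1.
split=> [u w|x u].
  have [t tm ->] := fcls_surj u; have [t' tm' ->] := fcls_surj w.
  rewrite -[X in fiber_lift _ X](fclsD tm tm') !fiber_lift_fcls //.
    exact: L.1.
  exact: spanD.
have [t tm ->] := fcls_surj u.
rewrite -[X in fiber_lift _ X](fclsZ x tm) !fiber_lift_fcls //; first exact: L.2.
exact: spanZ.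
Qed.

End FiberLift.

End FiberProduct.

Section FiberMap.
Variables (k : fieldType) (G : groupType) (B : gammaAlg k G).
Variables A C A' C' : bgalg B.

(* f \tilde\otimes g; only meaningful for morphisms f and g, see fiber_mapE. *)
Definition fiber_map := locked_with fiber_key
  (fun (f : A -> A') (g : C -> C') (u : fiber A C) =>
    fcls (tens_lift (fun a c => tmk (f a) (g c))
      (sub_val (repr (u : fiber_alg A C)))) : fiber A' C').

Variables (f : A -> A') (g : C -> C').
Hypotheses (fM : bgmorphism f) (gM : bgmorphism g).

Let F := tens_lift (fun a c => tmk (f a) (g c)).
Let fB := bilinear_comp (bgm_alg fM).1 (bgm_alg gM).1.
Let FL : klinear F := tens_lift_lin fB.
Let FE a c : F (tmk a c) = tmk (f a) (g c) := tens_liftE fB a c.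

Let F_matched t : span (@matched _ _ _ A C) t -> span (@matched _ _ _ A' C') (F t).
Proof.
apply: (span_mor FL) => _ [h [h'' [h' [a [c [ad cd ->]]]]]]; rewrite FE.
exact: tmk_matched (bgm_deg fM ad) (bgm_deg gM cd).
Qed.

Let F_inner t : span (@inner_rel _ _ _ A C) t -> span (@inner_rel _ _ _ A' C') (F t).
Proof.
apply: (span_mor FL) => _ [h [h'' [h' [a [c [b [ad cd ->]]]]]]].
rewrite (klinB _ _ FL) !FE (bgm_alg fM).2.2 (bgm_alg gM).2.2.
rewrite (bgm_s fM) (bgm_r gM); apply: span_mem.
exists h, h'', h', (f a), (g c), b; split=> //.
  exact: (bgm_deg fM).
exact: (bgm_deg gM).
Qed.

Lemma fiber_map_fcls t : span (@matched _ _ _ A C) t ->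
  fiber_map f g (fcls t) = fcls (F t).
Proof.
move=> tm; rewrite /fiber_map locked_withE -/F.
set t' := sub_val _.
have tm' : span (@matched _ _ _ A C) t' by exact: (@sub_mem _ _ (fiber_sub A C)).
have ti : span (@inner_rel _ _ _ A C) (t' - t).
  rewrite /t' fclsE -[X in _ - X](fiber_subE tm).
  rewrite -(klinB _ _ (@sub_val_lin _ _ (fiber_sub A C))).
  exact: ideal_inner (repr_qpi _ _).
rewrite -[t'](subrK t) FL.1 fclsD ?(fcls0 (F_inner ti)) ?add0r //.
  by rewrite (klinB _ _ FL); apply: spanB; apply: F_matched.
exact: F_matched.
Qed.

Lemma fiber_mapE h h' h'' a c : bg_deg h h' a -> bg_deg h' h'' c ->
  fiber_map f g (ftens a c) = ftens (f a) (g c).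
Proof.
by move=> ad cd; rewrite fiber_map_fcls ?FE //; apply: tmk_matched ad cd.
Qed.

Lemma fiber_map_mor : bgmorphism (fiber_map f g).
Proof.
have fmL : klinear (fiber_map f g).
  split=> [u w|x u].
    have [t tm ->] := fcls_surj u; have [t' tm' ->] := fcls_surj w.
    rewrite -[X in fiber_map _ _ X](fclsD tm tm') !fiber_map_fcls //.
      by rewrite FL.1 fclsD //; apply: F_matched.
    exact: spanD.
  have [t tm ->] := fcls_surj u.
  rewrite -[X in fiber_map _ _ X](fclsZ x tm) !fiber_map_fcls //.
    by rewrite FL.2 fclsZ //; apply: F_matched.
  exact: spanZ.
have fmr b : fiber_map f g (bg_r (fiber A C) b) = bg_r (fiber A' C') b.
  rewrite (fiber_mapE (bg_r_deg _ _) (bg_deg1 _)) (bgm_alg gM).2.1.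
  by rewrite (bgm_r fM).
have fms b : fiber_map f g (bg_s (fiber A C) b) = bg_s (fiber A' C') b.
  rewrite (fiber_mapE (bg_deg1 _) (bg_s_deg _ _)) (bgm_alg fM).2.1.
  by rewrite (bgm_s gM).
split=> //; last first.
  move=> h h'' u; apply: (span_mor fmL) => _ [h' [a [c [ad cd ->]]]].
  rewrite (fiber_mapE ad cd).
  exact: ftens_deg (bgm_deg fM ad) (bgm_deg gM cd).
split=> //; split.
  by rewrite -(bg_r_mor (fiber A C)).2.1 fmr (bg_r_mor (fiber A' C')).2.1.
move=> u w; elim/fiber_ind: u => [|u u' Hu Hu'|x u Hu|h h' h'' a c ad cd].
- by rewrite mul0r (klin0 fmL) mul0r.
- by rewrite mulrDl !fmL.1 Hu Hu' mulrDl.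
- by rewrite -pzscaleAl !fmL.2 Hu pzscaleAl.
elim/fiber_ind: w => [|u u' Hu Hu'|x u Hu|i i' i'' a' c' ad' cd'].
- by rewrite mulr0 (klin0 fmL) mulr0.
- by rewrite mulrDr !fmL.1 Hu Hu' mulrDr.
- by rewrite -pzscaleAr !fmL.2 Hu pzscaleAr.
rewrite (ftensM ad cd ad' cd').
rewrite (fiber_mapE (bg_degM ad ad') (bg_degM cd cd')).
rewrite (fiber_mapE ad cd) (fiber_mapE ad' cd').
rewrite (ftensM (bgm_deg fM ad) (bgm_deg gM cd) (bgm_deg fM ad') (bgm_deg gM cd')).
by rewrite (bgm_alg fM).2.2 (bgm_alg gM).2.2.
Qed.

End FiberMap.
Section CrossedProduct.
Variables (k : fieldType) (G : groupType) (B : gammaAlg k G).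

Definition crossed_alg := {malg B[G]}.
HB.instance Definition _ := GRing.Zmodule.on crossed_alg.
HB.instance Definition _ := GRing.Zmodule_isPzRing.Build crossed_alg
  (smulA (@mulgA G) (@act_mor k G B) (@actM k G B))
  (smul1 (@mul1g G) (@act_mor k G B) (@act1 k G B))
  (smulr1 (@mulg1 G) (@act_mor k G B))
  (smulDl ( *%g : G -> G -> G) (@act k G B))
  (smulDr ( *%g : G -> G -> G) (@act_mor k G B)).
HB.instance Definition _ := isPzAlgebra.Build k crossed_alg
  (@sscaleA _ _ _) (@sscale1 _ _ _) (@sscaleDr _ _ _) (@sscaleDl _ _ _)
  (sscaleAl ( *%g : G -> G -> G) (@act_mor k G B)) (sscaleAr ( *%g : G -> G -> G) (@act_mor k G B)).

(* The element b g of the crossed product. *)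
Definition crU (b : B) (g : G) : crossed_alg := mkmalgU g b.

Lemma crUM b g b' g' : crU b g * crU b' g' = crU (b * act g b') (g * g')%g.
Proof. exact: (smulUU _ (@act_mor k G B)). Qed.

Lemma crUZ c b g : c *:k crU b g = crU (c *:k b) g.
Proof. exact: sscaleU. Qed.

Lemma crUD b b' g : crU (b + b') g = crU b g + crU b' g.
Proof. exact: monalgUD. Qed.

Lemma crU0 g : crU 0 g = 0.
Proof. exact: monalgU0. Qed.

Lemma crossed_ind (P : crossed_alg -> Prop) :
  P 0 -> (forall b g, P (crU b g)) ->
  (forall x y, P x -> P y -> P (x + y)) -> forall x, P x.
Proof.
move=> P0 PU PD x; elim/malg_ind: x => [|g b|x y]; first exact: P0.
  exact: PU.
exact: PD.
Qed.

Lemma cr_coefZ c (x : crossed_alg) h : (c *:k x)@_h = c *:k (x@_h).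
Proof.
elim/crossed_ind: x => [|b g|x y Hx Hy].
- by rewrite pzscaler0 mcoeff0 pzscaler0.
- rewrite crUZ /crU !mcoeffU; case: eqP => _ //.
  by rewrite pzscaler0.
- by rewrite pzscaleDr !mcoeffD Hx Hy pzscaleDr.
Qed.

(* b g has degree (g, g); the components of degree (g, g') with g <> g'
   vanish. *)
Definition cr_deg g g' (x : crossed_alg) :=
  forall h, x@_h != 0 -> h = g /\ h = g'.

Definition cr_incl (b : B) : crossed_alg := crU b 1%g.

Lemma cr_degP g g' x : cr_deg g g' x ->
  exists b, x = crU b g /\ (g <> g' -> b = 0).
Proof.
move=> xd; exists (x@_g); split.
  apply/malgP => h; rewrite mcoeffU; case: eqP => [->|gh] //.
  by apply/eqP/contraT => /xd [hg _]; case: gh.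
by move=> gg'; apply/eqP/contraT => /xd [_ /gg'].
Qed.

Lemma cr_degU b g : cr_deg g g (crU b g).
Proof. by move=> h; rewrite mcoeffU; case: (eqVneq g h) => [->|_] //; rewrite eqxx. Qed.

Lemma cr_deg0 g g' : cr_deg g g' 0.
Proof. by move=> h; rewrite mcoeff0 eqxx. Qed.

Lemma cr_degD g g' x y : cr_deg g g' x -> cr_deg g g' y -> cr_deg g g' (x + y).
Proof.
move=> xd yd h; rewrite mcoeffD.
have [x0|/xd //] := eqVneq (x@_h) 0; rewrite x0 add0r; exact: yd.
Qed.

Lemma cr_degZ g g' c x : cr_deg g g' x -> cr_deg g g' (c *:k x).
Proof.
move=> xd h; rewrite cr_coefZ => cx; apply: xd.
by apply: contraNneq cx => ->; rewrite pzscaler0.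
Qed.

Lemma cr_deg_span x : span (fun y => exists g g', cr_deg g g' y) x.
Proof.
elim/crossed_ind: x => [|b g|x y]; first exact: span0; last exact: spanD.
by apply: span_mem; exists g, g; apply: cr_degU.
Qed.

Lemma cr_deg_indep (ds : seq (G * G)) (x : G * G -> crossed_alg) :
  uniq ds -> (forall d, cr_deg d.1 d.2 (x d)) -> \sum_(d <- ds) x d = 0 ->
  forall d, d \in ds -> x d = 0.
Proof.
move=> ds_uniq xdeg x0 d dds; apply/malgP => h; rewrite mcoeff0.
apply/eqP/contraT => xdh; have [h1 h2] := xdeg d h xdh.
have := congr1 (fun y : crossed_alg => y@_h) x0.
rewrite mcoeff0 (bigD1_seq d) //= mcoeffD.
have -> : (\sum_(e <- ds | e != d) x e)@_h = 0.
  apply: (big_ind (fun y : crossed_alg => y@_h = 0)) => [|y z y0 z0|e ed].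
  - exact: mcoeff0.
  - by rewrite mcoeffD y0 z0 addr0.
  apply/eqP/contraT => /xdeg [e1 e2]; case/negP: ed; apply/eqP.
  by rewrite (surjective_pairing e) (surjective_pairing d) -e1 -e2 -h1 -h2.
by rewrite addr0 => xd0; rewrite xd0 eqxx in xdh.
Qed.

Lemma cr_degM g g' h h' x y :
  cr_deg g g' x -> cr_deg h h' y -> cr_deg (g * h)%g (g' * h')%g (x * y).
Proof.
move=> /cr_degP[b [-> b0]] /cr_degP[c [-> c0]]; rewrite crUM => i.
rewrite mcoeffU; case: (eqVneq (g * h)%g i) => [<-|_]; rewrite ?eqxx // mulr1n => bc.
have [gg'|/eqP/b0 b0'] := eqVneq g g'; last by rewrite b0' mul0r eqxx in bc.
have [hh'|/eqP/c0 c0'] := eqVneq h h'; first by rewrite -gg' -hh'.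
by rewrite c0' (klin0 (act_mor B g).1) mulr0 eqxx in bc.
Qed.

Lemma cr_incl_mor : alg_morphism cr_incl.
Proof.
split; [split=> [x y|c x] | split=> [//|x y]]; rewrite /cr_incl.
- exact: crUD.
- by rewrite crUZ.
- by rewrite crUM mulg1 act1.
Qed.

Lemma cr_incl_deg b : cr_deg 1%g 1%g (cr_incl b).
Proof. exact: cr_degU. Qed.

Lemma cr_rs b b' : cr_incl b * cr_incl b' = cr_incl b' * cr_incl b.
Proof. by rewrite -!cr_incl_mor.2.2 mulrC. Qed.

Lemma cr_rC g g' x b : cr_deg g g' x -> x * cr_incl b = cr_incl (act g b) * x.
Proof.
by case/cr_degP=> [c [-> _]]; rewrite !crUM mulg1 mul1g act1 mulrC.
Qed.

Lemma cr_sC g g' x b : cr_deg g g' x -> x * cr_incl b = cr_incl (act g' b) * x.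
Proof.
case/cr_degP=> [c [-> c0]]; rewrite !crUM mulg1 mul1g act1 mulrC.
have [<-|/eqP/c0 ->] // := eqVneq g g'.
by rewrite !mulr0.
Qed.

Definition crossed : bgalg B := BGAlg
  cr_deg0 cr_degD cr_degZ cr_deg_span cr_deg_indep cr_degM
  cr_incl_mor cr_incl_mor cr_incl_deg cr_incl_deg cr_rs cr_rC cr_sC.

(* b g |-> g^-1 b = g^-1(b) g^-1 *)
Definition crossed_S (x : crossed) : crossed :=
  mlin (fun g b => crU (act g^-1%g b) g^-1%g) x.

Lemma crossed_SE b g : crossed_S (crU b g) = crU (act g^-1%g b) g^-1%g.
Proof.
by rewrite /crossed_S mlinU // => h x y; rewrite (act_mor B _).1.1 crUD.
Qed.

Section Hat.
Variable A : bgalg B.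

(* b g |-> r(b) *)
Definition r_hat (x : crossed) : A := mlin (fun _ b => bg_r A b) x.
(* b g |-> s(b) *)
Definition s_hat (x : crossed) : A := mlin (fun _ b => bg_s A b) x.
(* g b |-> s(b), where g b = g(b) g *)
Definition s_check (x : crossed) : A := mlin (fun g b => bg_s A (act g^-1%g b)) x.

Lemma r_hatE b g : r_hat (crU b g) = bg_r A b.
Proof. by rewrite /r_hat mlinU // => _; apply: (bg_r_mor A).1.1. Qed.

Lemma s_hatE b g : s_hat (crU b g) = bg_s A b.
Proof. by rewrite /s_hat mlinU // => _; apply: (bg_s_mor A).1.1. Qed.

Lemma s_checkE b g : s_check (crU 1 g * crU b 1%g) = bg_s A b.
Proof.
rewrite crUM mul1r mulg1 /s_check mlinU.
  by rewrite -actM mulVg act1.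
by move=> h x y; rewrite (act_mor B _).1.1 (bg_s_mor A).1.1.
Qed.

Lemma r_hat_lin : klinear r_hat.
Proof.
have D : {morph r_hat : x y / x + y}.
  by apply: mlinD => _; apply: (bg_r_mor A).1.1.
split=> // c x; elim/crossed_ind: x => [|b g|x y Hx Hy].
- by rewrite pzscaler0 /r_hat mlin0 pzscaler0.
- by rewrite crUZ !r_hatE (bg_r_mor A).1.2.
- by rewrite pzscaleDr !D Hx Hy pzscaleDr.
Qed.

Lemma s_hat_lin : klinear s_hat.
Proof.
have D : {morph s_hat : x y / x + y}.
  by apply: mlinD => _; apply: (bg_s_mor A).1.1.
split=> // c x; elim/crossed_ind: x => [|b g|x y Hx Hy].
- by rewrite pzscaler0 /s_hat mlin0 pzscaler0.
- by rewrite crUZ !s_hatE (bg_s_mor A).1.2.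
- by rewrite pzscaleDr !D Hx Hy pzscaleDr.
Qed.

Lemma r_hatM b x : r_hat (cr_incl b * x) = bg_r A b * r_hat x.
Proof.
elim/crossed_ind: x => [|c g|x y Hx Hy].
- by rewrite mulr0 (klin0 r_hat_lin) mulr0.
- by rewrite crUM act1 !r_hatE (bg_r_mor A).2.2.
- by rewrite mulrDr !r_hat_lin.1 Hx Hy mulrDr.
Qed.

Lemma s_hatM b x : s_hat (cr_incl b * x) = bg_s A b * s_hat x.
Proof.
elim/crossed_ind: x => [|c g|x y Hx Hy].
- by rewrite mulr0 (klin0 s_hat_lin) mulr0.
- by rewrite crUM act1 !s_hatE (bg_s_mor A).2.2.
- by rewrite mulrDr !s_hat_lin.1 Hx Hy mulrDr.
Qed.

(* (B x| G) \tilde\otimes A ~= A, b g \tilde\otimes a |-> r(b) a *)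
Definition lunit (u : fiber crossed A) : A :=
  fiber_lift (fun x a => r_hat x * a) u.
(* A \tilde\otimes (B x| G) ~= A, a \tilde\otimes b g |-> s(b) a *)
Definition runit (u : fiber A crossed) : A :=
  fiber_lift (fun a x => s_hat x * a) u.

Lemma lunit_balanced : balanced (C := A) (fun (x : crossed) a => r_hat x * a).
Proof.
split; first split=> [a|x]; try split=> [u w|c u].
- by rewrite r_hat_lin.1 mulrDl.
- by rewrite r_hat_lin.2 pzscaleAl.
- by rewrite mulrDr.
- by rewrite pzscaleAr.
move=> g g' g'' x a b _ _; rewrite [r_hat _]r_hatM mulrA; congr (_ * a).
elim/crossed_ind: x => [|c h|x y Hx Hy].
- by rewrite (klin0 r_hat_lin) mulr0 mul0r.
- by rewrite r_hatE -!(bg_r_mor A).2.2 mulrC.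
- by rewrite r_hat_lin.1 mulrDr mulrDl Hx Hy.
Qed.

Lemma runit_balanced : balanced (A := A) (fun a (x : crossed) => s_hat x * a).
Proof.
split; first split=> [x|a]; try split=> [u w|c u].
- by rewrite mulrDr.
- by rewrite pzscaleAr.
- by rewrite s_hat_lin.1 mulrDl.
- by rewrite s_hat_lin.2 pzscaleAl.
move=> g g' g'' a x b _ _; rewrite [s_hat (_ * _)]s_hatM mulrA; congr (_ * a).
elim/crossed_ind: x => [|c h|x y Hx Hy].
- by rewrite (klin0 s_hat_lin) mulr0 mul0r.
- by rewrite s_hatE -!(bg_s_mor A).2.2 mulrC.
- by rewrite s_hat_lin.1 mulrDr mulrDl Hx Hy.
Qed.

Lemma lunitE b g g' a : bg_deg g g' a -> lunit (ftens (crU b g : crossed) a) = bg_r A b * a.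
Proof.
move=> ad; rewrite /lunit (fiber_liftE lunit_balanced (@cr_degU b g) ad).
by rewrite r_hatE.
Qed.

Lemma runitE b g g' a : bg_deg g g' a -> runit (ftens a (crU b g' : crossed)) = bg_s A b * a.
Proof.
move=> ad; rewrite /runit (fiber_liftE runit_balanced ad (@cr_degU b g')).
by rewrite s_hatE.
Qed.

Lemma lunit_mor : bgmorphism lunit.
Proof.
have L : klinear lunit := fiber_lift_lin lunit_balanced.
have E g g' g'' (x : crossed) a : bg_deg g g' x -> bg_deg g' g'' a ->
  lunit (ftens x a) = r_hat x * a := @fiber_liftE _ _ _ _ _ _ _ lunit_balanced g g' g'' x a.
have lr b : lunit (bg_r (fiber crossed A) b) = bg_r A b.
  by rewrite (E _ _ _ _ _ (bg_r_deg _ _) (bg_deg1 _)) mulr1 r_hatE.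
have h1 : r_hat 1 = 1 by rewrite [r_hat _](r_hatE 1 1%g) (bg_r_mor A).2.1.
split=> //; last first.
- by move=> b; rewrite (E _ _ _ _ _ (bg_deg1 _) (bg_s_deg _ _)) h1 mul1r.
- move=> g g'' u ud; rewrite -[lunit u]addr0.
  elim: ud => [|c x y [g' [z [a [zd ad ->]]]] _ IH].
    by rewrite (klin0 L) addr0; apply: bg_deg0.
  rewrite addr0 in IH; rewrite addr0 L.1 L.2; apply: bg_degD => //.
  apply: bg_degZ; rewrite (E _ _ _ _ _ zd ad).
  have [b [-> b0]] := cr_degP zd; rewrite r_hatE.
  have [->|/eqP/b0 ->] := eqVneq g g'; first exact: deg_rmul.
  by rewrite (klin0 (bg_r_mor A).1) mul0r; apply: bg_deg0.
split=> //; split.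
  by rewrite -(bg_r_mor (fiber crossed A)).2.1 lr (bg_r_mor A).2.1.
move=> u w; elim/fiber_ind: u => [|u u' Hu Hu'|x u Hu|h h' h'' z a zd ad].
- by rewrite mul0r (klin0 L) mul0r.
- by rewrite mulrDl !L.1 Hu Hu' mulrDl.
- by rewrite -pzscaleAl !L.2 Hu pzscaleAl.
elim/fiber_ind: w => [|u u' Hu Hu'|x u Hu|i i' i'' z' a' zd' ad'].
- by rewrite mulr0 (klin0 L) mulr0.
- by rewrite mulrDr !L.1 Hu Hu' mulrDr.
- by rewrite -pzscaleAr !L.2 Hu pzscaleAr.
rewrite (ftensM zd ad zd' ad').
apply: etrans (E _ _ _ _ _ (bg_degM zd zd') (bg_degM ad ad')) _.
rewrite (E _ _ _ _ _ zd ad) (E _ _ _ _ _ zd' ad').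
have [b [-> b0]] := cr_degP zd; have [b' [-> _]] := cr_degP zd'.
rewrite [X in r_hat X]crUM !r_hatE (bg_r_mor A).2.2 -!mulrA.
have [hh'|/eqP/b0 ->] := eqVneq h h'.
  by congr (_ * _); rewrite !mulrA (bg_rC _ ad) hh'.
by rewrite (klin0 (bg_r_mor A).1) !mul0r.
Qed.

Lemma runit_mor : bgmorphism runit.
Proof.
have L : klinear runit := fiber_lift_lin runit_balanced.
have E g g' g'' a (x : crossed) : bg_deg g g' a -> bg_deg g' g'' x ->
  runit (ftens a x) = s_hat x * a := @fiber_liftE _ _ _ _ _ _ _ runit_balanced g g' g'' a x.
have rs b : runit (bg_s (fiber A crossed) b) = bg_s A b.
  by rewrite (E _ _ _ _ _ (bg_deg1 _) (bg_s_deg _ _)) mulr1 s_hatE.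
have h1 : s_hat 1 = 1 by rewrite [s_hat _](s_hatE 1 1%g) (bg_s_mor A).2.1.
split=> //; last first.
- by move=> b; rewrite (E _ _ _ _ _ (bg_r_deg _ _) (bg_deg1 _)) h1 mul1r.
- move=> g g'' u ud; rewrite -[runit u]addr0.
  elim: ud => [|c x y [g' [a [z [ad zd ->]]]] _ IH].
    by rewrite (klin0 L) addr0; apply: bg_deg0.
  rewrite addr0 in IH; rewrite addr0 L.1 L.2; apply: bg_degD => //.
  apply: bg_degZ; rewrite (E _ _ _ _ _ ad zd).
  have [b [-> b0]] := cr_degP zd; rewrite s_hatE.
  have [<-|/eqP/b0 ->] := eqVneq g' g''; first exact: deg_smul.
  by rewrite (klin0 (bg_s_mor A).1) mul0r; apply: bg_deg0.
split=> //; split.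
  by rewrite -(bg_s_mor (fiber A crossed)).2.1 rs (bg_s_mor A).2.1.
move=> u w; elim/fiber_ind: u => [|u u' Hu Hu'|x u Hu|h h' h'' a z ad zd].
- by rewrite mul0r (klin0 L) mul0r.
- by rewrite mulrDl !L.1 Hu Hu' mulrDl.
- by rewrite -pzscaleAl !L.2 Hu pzscaleAl.
elim/fiber_ind: w => [|u u' Hu Hu'|x u Hu|i i' i'' a' z' ad' zd'].
- by rewrite mulr0 (klin0 L) mulr0.
- by rewrite mulrDr !L.1 Hu Hu' mulrDr.
- by rewrite -pzscaleAr !L.2 Hu pzscaleAr.
rewrite (ftensM ad zd ad' zd').
apply: etrans (E _ _ _ _ _ (bg_degM ad ad') (bg_degM zd zd')) _.
rewrite (E _ _ _ _ _ ad zd) (E _ _ _ _ _ ad' zd').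
have [b [-> b0]] := cr_degP zd; have [b' [-> _]] := cr_degP zd'.
rewrite [X in s_hat X]crUM !s_hatE (bg_s_mor A).2.2 -!mulrA.
by congr (_ * _); rewrite !mulrA (bg_sC _ ad).
Qed.

End Hat.
End CrossedProduct.
Section CoOpposite.
Variables (k : fieldType) (G : groupType) (B : gammaAlg k G) (A : bgalg B).

Definition coop_deg g g' (x : A^c) := bg_deg g'^-1%g g^-1%g (x : A).

Let flip (d : G * G) := (d.2^-1%g, d.1^-1%g).

Let flipK : involutive flip.
Proof. by case=> g h; rewrite /flip /= !invgK. Qed.

Lemma coop_deg_span (x : A^c) : span (fun y => exists g g', coop_deg g g' y) x.
Proof.
have idL : klinear (fun x : A => x : A^c) by [].
apply: (span_mor idL) (bg_deg_span (x : A)) => y [g [g' yd]].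
by apply: span_mem; exists g'^-1%g, g^-1%g; rewrite /coop_deg !invgK.
Qed.

Lemma coop_deg_indep (ds : seq (G * G)) (x : G * G -> A^c) :
  uniq ds -> (forall d, coop_deg d.1 d.2 (x d)) -> \sum_(d <- ds) x d = 0 ->
  forall d, d \in ds -> x d = 0.
Proof.
move=> ds_uniq xdeg x0 d dds; rewrite -[d]flipK.
apply: (@bg_deg_indep _ _ _ A (map flip ds) (fun e => x (flip e))).
- by rewrite map_inj_uniq //; apply: can_inj flipK.
- by move=> e; have := xdeg (flip e); rewrite /coop_deg /= !invgK.
- by rewrite big_map -[RHS]x0; apply: eq_bigr => e _; rewrite flipK.
- exact: map_f.
Qed.

Lemma coop_degM g g' h h' (x y : A^c) :
  coop_deg g g' x -> coop_deg h h' y -> coop_deg (g * h)%g (g' * h')%g (x * y).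
Proof. by rewrite /coop_deg !invgM => xd yd; apply: bg_degM yd xd. Qed.

Lemma coop_mor (f : B -> A) : alg_morphism f -> alg_morphism (f : B -> A^c).
Proof.
by case=> fL [f1 fM]; split=> //; split=> // x y; rewrite mulrC [LHS]fM.
Qed.

Lemma coop_r_deg b : coop_deg 1%g 1%g (bg_s A b).
Proof. by rewrite /coop_deg invg1; apply: bg_s_deg. Qed.

Lemma coop_s_deg b : coop_deg 1%g 1%g (bg_r A b).
Proof. by rewrite /coop_deg invg1; apply: bg_r_deg. Qed.

Lemma coop_rs b b' :
  (bg_s A b : A^c) * (bg_r A b' : A^c) = (bg_r A b' : A^c) * (bg_s A b : A^c).
Proof. exact: (bg_rs A b' b). Qed.

Lemma coop_rC g g' (a : A^c) b : coop_deg g g' a ->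
  a * (bg_s A b : A^c) = (bg_s A (act g b) : A^c) * a.
Proof. by move=> ad; apply: esym; rewrite [LHS](bg_sC _ ad) -actM mulVg act1. Qed.

Lemma coop_sC g g' (a : A^c) b : coop_deg g g' a ->
  a * (bg_r A b : A^c) = (bg_r A (act g' b) : A^c) * a.
Proof. by move=> ad; apply: esym; rewrite [LHS](bg_rC _ ad) -actM mulVg act1. Qed.

Definition coop : bgalg B := @BGAlg _ _ _ (A^c : pzAlgType k)
  coop_deg (bg_s A) (bg_r A)
  (fun g g' => bg_deg0 A g'^-1 g^-1) (fun g g' => @bg_degD _ _ _ A g'^-1 g^-1)
  (fun g g' => @bg_degZ _ _ _ A g'^-1 g^-1) coop_deg_span coop_deg_indep coop_degM
  (coop_mor (bg_s_mor A)) (coop_mor (bg_r_mor A)) coop_r_deg coop_s_deg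
  coop_rs coop_rC coop_sC.

End CoOpposite.

Section HopfAlgebroids.
Variables (k : fieldType) (G : groupType) (B : gammaAlg k G).

(* u and w correspond to each other under the associativity isomorphism
   (x \tilde\otimes y) \tilde\otimes z |-> x \tilde\otimes (y \tilde\otimes z);
   the list ranges over homogeneous elements of matching degrees. *)
Definition fiber_assoc (A C D : bgalg B) (u : fiber (fiber A C) D)
    (w : fiber A (fiber C D)) : Prop :=
  exists L : seq (A * C * D),
  [/\ forall t, t \in L -> exists g g' g'' g''',
        [/\ bg_deg g g' t.1.1, bg_deg g' g'' t.1.2 & bg_deg g'' g''' t.2],
      u = \sum_(t <- L) ftens (ftens t.1.1 t.1.2 : fiber A C) t.2 &
      w = \sum_(t <- L) ftens t.1.1 (ftens t.1.2 t.2 : fiber C D)].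

Record hopf_algebroid := HopfAlgebroid {
  ha_alg :> bgalg B;
  Delta : ha_alg -> fiber ha_alg ha_alg;
  counit : ha_alg -> crossed B;
  antipode : ha_alg -> ha_alg;
  Delta_mor : bgmorphism Delta;
  counit_mor : bgmorphism counit;
  antipode_mor : @bgmorphism _ _ _ ha_alg (coop ha_alg) antipode;
  coassoc : forall a,
    fiber_assoc (fiber_map Delta id (Delta a)) (fiber_map id Delta (Delta a));
  counitl : forall a, lunit (fiber_map counit id (Delta a)) = a;
  counitr : forall a, runit (fiber_map id counit (Delta a)) = a;
  antipodel : forall a,
    fiber_lift (fun x y => antipode x * y) (Delta a) = s_check _ (counit a);
  antipoder : forall a,
    fiber_lift (fun x y => x * antipode y) (Delta a) = r_hat _ (counit a)
}.

(* The two antipode axioms do not depend on the representative chosen by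
   fiber_lift. *)
Lemma antipodel_balanced (A : hopf_algebroid) :
  balanced (fun x y : A => antipode x * y).
Proof.
have [[SL [_ SM]] _ Sr Ss] := antipode_mor A.
split; first split=> [y|x]; try split=> [u w|c u].
- by rewrite [antipode _]SL.1 mulrDl.
- by rewrite [antipode _]SL.2 pzscaleAl.
- by rewrite mulrDr.
- by rewrite pzscaleAr.
move=> g g' g'' x y b _ _; rewrite [antipode _]SM [antipode (bg_s A b)]Ss.
by rewrite mulrA.
Qed.

Lemma antipoder_balanced (A : hopf_algebroid) :
  balanced (fun x y : A => x * antipode y).
Proof.
have [[SL [_ SM]] Sd Sr Ss] := antipode_mor A.
split; first split=> [y|x]; try split=> [u w|c u].
- by rewrite mulrDl.
- by rewrite pzscaleAl.
- by rewrite [antipode _]SL.1 mulrDr.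
- by rewrite [antipode _]SL.2 pzscaleAr.
move=> g g' g'' x y b xd yd; rewrite [antipode (_ * y)]SM [antipode (bg_r A b)]Sr.
have Syd : bg_deg g''^-1%g g'^-1%g (antipode y : A) := Sd _ _ _ yd.
rewrite [X in _ = _ * X](bg_sC _ Syd) mulrA (bg_sC _ xd).
by rewrite -actM mulgV act1.
Qed.

End HopfAlgebroids.

Section CharacterGroups.
Variables (k : fieldType) (G : groupType) (B : gammaAlg k G).
Variable A : hopf_algebroid B.

(* On (B x| G) \tilde\otimes (B x| G) the map lunit is
   b g \tilde\otimes b' g |-> b b' g. *)
Record character_group (theta : int -> A -> crossed B) : Prop := CharacterGroup {
  chg_mor : forall i, bgmorphism (theta i);
  chg_add : forall i j a,
    lunit (fiber_map (theta i) (theta j) (Delta a)) = theta (i + j) a;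
  chg_0 : forall a, theta 0 a = counit a;
  chg_S : forall i a, theta i (antipode a) = crossed_S (theta (- i) a)
}.

Definition Delta2 (a : A) : fiber (fiber A A) A :=
  fiber_map (@Delta _ _ _ A) id (Delta a).

(* runit o (lunit \tilde\otimes id) is
   (b g \tilde\otimes a) \tilde\otimes b' g' |-> r(b) s(b') a. *)
Definition scaling (theta : int -> A -> crossed B) : Prop := forall a,
  antipode (antipode a) =
  runit (fiber_map (@lunit _ _ _ A) id
    (fiber_map (fiber_map (theta 1) id) (theta (-1)) (Delta2 a))).

End CharacterGroups.

Section FreeOrthogonal.
Variables (k : fieldType) (G : groupType) (B : gammaAlg k G) (n : nat).

Definition mx_inverse (R : pzRingType) (v w : 'M[R]_n) :=
  v *m w = 1%:M /\ w *m v = 1%:M.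

Definition nabla (g : 'I_n -> G) : 'M[crossed B]_n :=
  diag_mx (\row_i (crU 1 (g i) : crossed B)).

Definition mx_incl (M : 'M[B]_n) : 'M[crossed B]_n :=
  map_mx (@cr_incl _ _ B : B -> crossed B) M.

(* F' stands for nabla F nabla, an element of M_n(B) when F is nabla-odd. *)
Definition orthogonal_rel (g : 'I_n -> G) (F F' : 'M[B]_n) (A : bgalg B)
    (v : 'M[A]_n) : Prop :=
  (forall i j, bg_deg (g i) (g j) (v i j)) /\
  exists2 w : 'M[A]_n, mx_inverse v w &
    map_mx (bg_r A) F' *m w^T = v *m map_mx (bg_s A) F.

Record free_orthogonal (g : 'I_n -> G) (F F' : 'M[B]_n)
    (A : hopf_algebroid B) (v : 'M[A]_n) : Prop := FreeOrthogonal {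
  fo_rel : orthogonal_rel g F F' v;
  fo_universal : forall (D : bgalg B) (u : 'M[D]_n), orthogonal_rel g F F' u ->
    exists phi : A -> D, [/\ bgmorphism phi, map_mx phi v = u &
      forall psi : A -> D, bgmorphism psi -> map_mx psi v = u -> psi =1 phi];
  fo_Delta : forall i j, Delta (v i j) = \sum_l (ftens (v i l) (v l j) : fiber A A);
  fo_counit : forall i j, counit (v i j) = (crU 1 (g i) : crossed B) *+ (i == j);
  fo_antipode : mx_inverse v (map_mx (@antipode _ _ _ A) v)
}.

Definition intertwiner (g : 'I_n -> G) (A : bgalg B) (H : 'M[B]_n)
    (v w : 'M[A]_n) : Prop :=
  exists2 H' : 'M[B]_n,
    mx_incl H' = nabla g *m mx_incl H *m nabla (fun i => (g i)^-1%g) &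
    map_mx (bg_r A) H' *m v = w *m map_mx (bg_s A) H.

(* H^i for i : int, given the inverse Hinv of H. *)
Definition mxpowz (H Hinv : 'M[B]_n) (i : int) : 'M[B]_n :=
  match i with Posz m => H ^+ m | Negz m => Hinv ^+ m.+1 end.

End FreeOrthogonal.

(* Main.v *)
(* Writing N = nabla F nabla, oddness of F means that F_ij vanishes unless
   g_i = g_j^-1, and then N_ij = g_i(F_ij); the same holds for F^-1, so N is
   invertible and H = N^T F^-1 is block diagonal for the values of g.
   Applying S to N v^-T = v F entrywise gives S^2(v) N^T = F^T v^-T; eliminating
   v^-T yields the intertwiner relation, because nabla H nabla^-1 = F^T N^-1.
   Since F (nabla H^-i nabla^-1)^T = H^i F, the matrices nabla H^i satisfy the
   defining relation over the crossed product, so the universal property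
   provides theta^(i).  Every remaining identity is between morphisms, and
   these are determined by their values on v. *)
Require Import Defs.
From mathcomp Require Import all_boot all_algebra.
From mathcomp Require Import boolp monalg.

Set Implicit Arguments.
Unset Strict Implicit.
Unset Printing Implicit Defensive.

Import GRing.Theory.

Local Open Scope ring_scope.

(** * Morphisms of $(B,\Gamma)$-algebras and their co-opposites *)

Section Morphisms.
Variables (k : fieldType) (G : groupType) (B : gammaAlg k G).

Lemma bgm_id (A : bgalg B) : bgmorphism (id : A -> A).
Proof. by []. Qed.

Lemma bgm_comp (A C D : bgalg B) (f : C -> D) (h : A -> C) :
  bgmorphism f -> bgmorphism h -> bgmorphism (f \o h).
Proof.
move=> [[fL [f1 fM]] fd fr fs] [[hL [h1 hM]] hd hr hs]; split=> /=.
- split; first exact: klin_comp.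
  by split=> [|x y] /=; rewrite ?h1 ?hM.
- by move=> g g' a /hd /fd.
- by move=> b; rewrite hr.
- by move=> b; rewrite hs.
Qed.

Lemma bgm_coop (A C : bgalg B) (f : A -> C) :
  bgmorphism f -> @bgmorphism _ _ _ (coop A) (coop C) f.
Proof.
case=> [[fL [f1 fM]] fd fr fs]; split=> //.
- by split=> //; split=> // x y; apply: fM.
- by move=> g g' a; apply: fd.
Qed.

(** The double co-opposite has the product, [r] and [s] of [C] by conversion; only the degrees are
    inverted twice. Hence the square of an antipode is a morphism. *)
Lemma bgm_coopK (A C : bgalg B) (f : A -> C) :
  @bgmorphism _ _ _ A (coop (coop C)) f -> bgmorphism f.
Proof.
case=> [[fL [f1 fM]] fd fr fs]; split=> //.
by move=> g g' a /fd; rewrite /= /coop_deg /= /coop_deg !invgK.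
Qed.

Lemma antipode2_mor (A : hopf_algebroid B) :
  bgmorphism (@antipode k G B A \o @antipode k G B A).
Proof.
apply: bgm_coopK.
exact: (bgm_comp (bgm_coop (antipode_mor A)) (antipode_mor A)).
Qed.

Lemma crossed_S_mor : @bgmorphism _ _ _ (crossed B) (coop (crossed B)) (@crossed_S k G B).
Proof.
have SD : {morph (@crossed_S k G B) : x y / x + y}.
  by apply: mlinD => h x y; rewrite (act_mor B _).1.1 crUD.
have S0 : crossed_S (0 : crossed B) = 0 by apply: mlin0.
have S1 : crossed_S (1 : crossed B) = 1.
  by rewrite [LHS](crossed_SE (1 : B)) (act_mor B _).2.1 invg1.
split=> [|g g' x /cr_degP[b [-> b0]]|b|b].
- split; first split=> // c x.
    elim/crossed_ind: x => [|b g|x y Hx Hy].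
    + by rewrite pzscaler0 S0 pzscaler0.
    + by rewrite crUZ !crossed_SE (act_mor B _).1.2 -crUZ.
    + by rewrite pzscaleDr !SD Hx Hy pzscaleDr.
  split=> // x y; rewrite [RHS](_ : _ = (crossed_S y : crossed B) * crossed_S x) //.
  elim/crossed_ind: x => [|b g|x x' Hx Hx'].
  + by rewrite mul0r S0 mulr0.
  + elim/crossed_ind: y => [|c h|y y' Hy Hy'].
    * by rewrite mulr0 S0 mul0r.
    * rewrite [X in crossed_S X]crUM !crossed_SE [RHS]crUM; congr crU.
        by rewrite (act_mor B _).2.2 invgM !actM -(actM g^-1%g g) mulVg act1 mulrC.
      by rewrite invgM.
    * by rewrite mulrDr !SD Hy Hy' mulrDl.
  + by rewrite mulrDl !SD Hx Hx' mulrDr.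
- rewrite crossed_SE /= /coop_deg /=.
  have [<-|/eqP/b0 ->] := eqVneq g g'; first exact: cr_degU.
  by rewrite (klin0 (act_mor B _).1) crU0; apply: cr_deg0.
- by rewrite [LHS]crossed_SE invg1 act1.
- by rewrite [LHS]crossed_SE invg1 act1.
Qed.

End Morphisms.

(** * Entrywise images of matrices under algebra morphisms *)

Section MatrixMaps.
Variables (k : fieldType) (A C : pzAlgType k) (f : A -> C).
Hypothesis f_mor : alg_morphism f.

Lemma alg_map_mxM m n p (M : 'M[A]_(m, n)) (N : 'M[A]_(n, p)) :
  map_mx f (M *m N) = map_mx f M *m map_mx f N.
Proof.
apply/matrixP=> i j; rewrite !mxE (klin_sum _ _ _ f_mor.1).
by apply: eq_bigr => l _; rewrite f_mor.2.2 !mxE.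
Qed.

Lemma alg_map_mx1 n : map_mx f (1%:M : 'M_n) = 1%:M.
Proof.
apply/matrixP=> i j; rewrite !mxE.
by case: eqP => _; rewrite ?f_mor.2.1 // (klin0 f_mor.1).
Qed.

Lemma alg_mx_inverse n (v w : 'M[A]_n) :
  mx_inverse v w -> mx_inverse (map_mx f v) (map_mx f w).
Proof. by case=> vw wv; rewrite /mx_inverse -!alg_map_mxM vw wv alg_map_mx1. Qed.

End MatrixMaps.

Lemma mx_inverse_uniq (R : pzRingType) n (v w w' : 'M[R]_n) :
  mx_inverse v w -> mx_inverse v w' -> w = w'.
Proof. by case=> _ wv [vw' _]; rewrite -[w]mulmx1 -vw' mulmxA wv mul1mx. Qed.

(** * Morphisms out of the free orthogonal dynamical quantum group *)

Section FreeOrthogonalMorphisms.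
Variables (k : fieldType) (G : groupType) (B : gammaAlg k G) (n : nat).
Variables (g : 'I_n -> G) (F F' : 'M[B]_n).

Lemma orthogonal_rel_map (A D : bgalg B) (f : A -> D) (v : 'M[A]_n) :
  bgmorphism f -> orthogonal_rel g F F' v -> orthogonal_rel g F F' (map_mx f v).
Proof.
move=> fM [vd [w vw vE]]; split=> [i j|]; first by rewrite mxE; apply: (bgm_deg fM).
exists (map_mx f w); first exact: alg_mx_inverse (bgm_alg fM) _ _ _ vw.
have fr : map_mx (bg_r D) F' = map_mx f (map_mx (bg_r A) F').
  by apply/matrixP=> i j; rewrite !mxE (bgm_r fM).
have fs : map_mx (bg_s D) F = map_mx f (map_mx (bg_s A) F).
  by apply/matrixP=> i j; rewrite !mxE (bgm_s fM).
by rewrite fr fs map_trmx -!(alg_map_mxM (bgm_alg fM)) vE.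
Qed.

(** The image of [v] under [f] again satisfies the defining relation, so the universal property
    yields one map that both [f] and [h] must equal. *)
Lemma free_orthogonal_ext (A : hopf_algebroid B) (v : 'M[A]_n) (D : bgalg B)
    (f h : A -> D) :
  free_orthogonal g F F' v -> bgmorphism f -> bgmorphism h ->
  map_mx f v = map_mx h v -> f =1 h.
Proof.
move=> vfree fM hM fh a.
have [phi [_ _ phiU]] := fo_universal vfree (orthogonal_rel_map fM (fo_rel vfree)).
by rewrite (phiU f) // (phiU h).
Qed.

End FreeOrthogonalMorphisms.

(** * Twisting matrices over [B] by group elements *)

Section GradedMatrices.
Variables (k : fieldType) (G : groupType) (B : gammaAlg k G) (n : nat).
Implicit Types (g h : 'I_n -> G) (M N F : 'M[B]_n).

(* Conjugation of matrices over B by diagonal matrices of group elements: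
   [nabla M nabla^-1] lies in M_n(B) iff [mx_even g M], and [nabla M nabla] does
   iff [mx_odd g M]; in both cases the value is [mx_twist g M]. *)
Definition mx_even g M := forall i j, g i != g j -> M i j = 0.
Definition mx_odd g M := forall i j, g i != (g j)^-1%g -> M i j = 0.
Definition mx_twist g M : 'M[B]_n := \matrix_(i, j) act (g i) (M i j).

Lemma mx_twist1 g : mx_twist g 1%:M = 1%:M.
Proof.
apply/matrixP=> i j; rewrite !mxE; case: eqP => _.
  exact: (act_mor B _).2.1.
exact: (klin0 (act_mor B _).1).
Qed.

(** A nonzero [M i l] forces [g i = h l], so the action of [g i] on [N l j] is that of [h l]. Two
    families are allowed because odd matrices lead from [g] to its inverses. *)
Lemma mx_twistM g h M N : (forall i j, g i != h j -> M i j = 0) ->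
  mx_twist g (M *m N) = mx_twist g M *m mx_twist h N.
Proof.
move=> Mgh; apply/matrixP=> i j; rewrite !mxE (klin_sum _ _ _ (act_mor B _).1).
apply: eq_bigr => l _; rewrite !mxE (act_mor B _).2.2.
have [->//|il] := eqVneq (g i) (h l).
by rewrite Mgh // (klin0 (act_mor B _).1) !mul0r.
Qed.

Lemma mx_twistV g M : mx_twist (fun i => (g i)^-1%g) (mx_twist g M) = M.
Proof. by apply/matrixP=> i j; rewrite !mxE -actM mulVg act1. Qed.

Lemma mx_twist_tr g h M : (forall i j, g i != h j -> M i j = 0) ->
  (mx_twist g M)^T = mx_twist h M^T.
Proof.
move=> Mgh; apply/matrixP=> i j; rewrite !mxE.
have [->//|ij] := eqVneq (g j) (h i).
by rewrite Mgh // !(klin0 (act_mor B _).1).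
Qed.

Lemma mx_even1 g : mx_even g 1%:M.
Proof. by move=> i j; rewrite mxE; have [->|//] := eqVneq i j; rewrite eqxx. Qed.

Lemma mx_evenM g M N : mx_even g M -> mx_even g N -> mx_even g (M *m N).
Proof.
move=> Me Ne i j gij; rewrite mxE big1 // => l _.
have [il|il] := eqVneq (g i) (g l); last by rewrite Me ?mul0r.
by rewrite Ne ?mulr0 // -il.
Qed.

Lemma mx_odd_tr g M : mx_odd g M -> mx_odd g M^T.
Proof.
move=> Mo i j ij; rewrite mxE Mo //; apply: contraNneq ij => ->.
by rewrite invgK.
Qed.

Lemma mx_odd_twist g h M : mx_odd g M -> mx_odd g (mx_twist h M).
Proof. by move=> Mo i j /Mo; rewrite mxE => ->; apply: (klin0 (act_mor B _).1). Qed.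

Lemma mx_even_mul_odd g M N : mx_even g M -> mx_odd g N -> mx_odd g (M *m N).
Proof.
move=> Me No i j gij; rewrite mxE big1 // => l _.
have [il|il] := eqVneq (g i) (g l); last by rewrite Me ?mul0r.
by rewrite No ?mulr0 // -il.
Qed.

Lemma mx_odd_mul_odd g M N : mx_odd g M -> mx_odd g N -> mx_even g (M *m N).
Proof.
move=> Mo No i j gij; rewrite mxE big1 // => l _.
have [il|il] := eqVneq (g i) (g l)^-1%g; last by rewrite Mo ?mul0r.
rewrite No ?mulr0 //; apply: contraNneq gij => lj.
by rewrite il lj invgK.
Qed.

(* The odd part of the inverse of [F] is itself a right inverse of [F]. *)
Lemma mx_odd_inv g F Finv : mx_inverse F Finv -> mx_odd g F -> mx_odd g Finv.
Proof.
move=> FF Fo.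
pose P : 'M[B]_n := \matrix_(i, j) (Finv i j *+ (g i == (g j)^-1%g)).
suff FP : F *m P = 1%:M.
  move=> i j ij; have -> : Finv = P by rewrite -[LHS]mulmx1 -FP mulmxA FF.2 mul1mx.
  by rewrite mxE (negbTE ij).
apply/matrixP=> i j.
have -> : (F *m P) i j = (F *m Finv) i j *+ (g i == g j).
  rewrite !mxE -sumrMnl; apply: eq_bigr => l _; rewrite mxE mulrnAr.
  have [->|il] := eqVneq (g i) (g l)^-1%g; last by rewrite Fo // mul0r !mul0rn.
  by rewrite (can2_eq (@invgK _) (@invgK _)).
rewrite FF.1 mxE; have [->|_] := eqVneq i j; first by rewrite eqxx.
by rewrite mul0rn.
Qed.

Lemma mx_inclM M N : mx_incl (M *m N) = mx_incl M *m mx_incl N.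
Proof. exact: (alg_map_mxM (cr_incl_mor B)). Qed.

Lemma mx_incl1 : mx_incl (1%:M : 'M[B]_n) = 1%:M.
Proof. exact: (alg_map_mx1 (cr_incl_mor B)). Qed.

Lemma nabla_mulE g M i j :
  (nabla B g *m mx_incl M) i j = crU (mx_twist g M i j) (g i).
Proof. by rewrite /nabla mul_diag_mx !mxE [LHS]crUM mul1r mulg1. Qed.

Lemma mul_nablaE g M i j :
  (mx_incl M *m nabla B g) i j = crU (M i j) (g j).
Proof.
by rewrite /nabla mul_mx_diag !mxE [LHS]crUM (act_mor B _).2.1 mulr1 mul1g.
Qed.

Lemma nabla_conjE g h M i j :
  (nabla B g *m mx_incl M *m nabla B h) i j =
  crU (mx_twist g M i j) (g i * h j)%g.
Proof.
rewrite {2}/nabla mul_mx_diag mxE nabla_mulE !mxE [LHS]crUM.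
by rewrite (act_mor B _).2.1 mulr1.
Qed.

Lemma nablaV g : mx_inverse (nabla B g) (nabla B (fun i => (g i)^-1%g)).
Proof.
split; apply/matrixP=> i j; rewrite -[X in X *m _]mulmx1 -mx_incl1;
  rewrite nabla_conjE mx_twist1 !mxE; case: eqP => [->|_];
  by rewrite ?mulgV ?mulVg // [LHS]crU0 [RHS]crU0.
Qed.

(** Each entry is supported at 1 on the left and at [g i * g j] on the right. Where these differ,
    the coefficient at [g i * g j] kills [F i j]; where they agree, the coefficients at 1 give
    [F' i j]. *)
Lemma mx_oddP g F F' :
  mx_incl F' = nabla B g *m mx_incl F *m nabla B g ->
  mx_odd g F /\ F' = mx_twist g F.
Proof.
move=> E.
have Eij i j (h : G) :
    (F' i j) *+ (1%g == h) = act (g i) (F i j) *+ ((g i * g j)%g == h).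
  move/matrixP/(_ i j): E; rewrite nabla_conjE !mxE.
  by move/(congr1 (fun x : crossed_alg B => mcoeff h x)); rewrite !mcoeffU.
have Fo : mx_odd g F.
  move=> i j ij; have := Eij i j (g i * g j)%g; rewrite eqxx.
  rewrite (_ : (1 == _)%g = false) => [/esym|]; last first.
    by apply: contraNF ij => /eqP/esym/mulg1_eq <-; rewrite invgK.
  move/(congr1 (act (g i)^-1%g)); rewrite -actM mulVg act1 => ->.
  exact: (klin0 (act_mor B _).1).
split=> //; apply/matrixP=> i j; rewrite mxE.
have := Eij i j 1%g; rewrite eqxx mulr1n => ->.
have [->|ij] := eqVneq (g i) (g j)^-1%g; first by rewrite mulVg eqxx.
by rewrite Fo // (klin0 (act_mor B _).1) mul0rn.
Qed.

Lemma mx_even_twistE g M : mx_even g M ->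
  mx_incl (mx_twist g M) =
  nabla B g *m mx_incl M *m nabla B (fun i => (g i)^-1%g).
Proof.
move=> Me; apply/matrixP=> i j; rewrite nabla_conjE mxE.
have [->|ij] := eqVneq (g i) (g j); first by rewrite mulgV.
by rewrite mxE Me // (klin0 (act_mor B _).1) crU0 [LHS]crU0.
Qed.

End GradedMatrices.

(** * Integer powers of an invertible matrix *)

Section IntegerPowers.
Variables (k : fieldType) (G : groupType) (B : gammaAlg k G) (n : nat).
Variables H Hinv : 'M[B]_n.
Hypothesis HH : mx_inverse H Hinv.

Lemma mxpowz_ind (P : 'M[B]_n -> Prop) : P 1%:M ->
  (forall M, P M -> P (M *m H)) -> (forall M, P M -> P (M *m Hinv)) ->
  forall i, P (mxpowz H Hinv i).
Proof.
move=> P1 PH PV [] m /=; first by elim: m => // m IH; rewrite exprSr; apply: PH.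
by elim: m => [|m IH]; rewrite exprSr; apply: PV.
Qed.

Lemma mxpowz_addr1 i : mxpowz H Hinv (i + 1) = mxpowz H Hinv i *m H.
Proof.
case: i => [m|[|m]].
- by rewrite -PoszD addn1 /= exprSr.
- by rewrite NegzE addNr /= expr1 HH.2.
(* [Negz m] is -(m+1), so the exponent of [Hinv] drops from m+2 to m+1. *)
- have -> : Negz m.+1 + 1 = Negz m by rewrite !NegzE -[m.+2]addn1 PoszD opprD subrK.
  by rewrite /= [in RHS]exprSr -[RHS]mulmxA HH.2 mulmx1.
Qed.

Lemma mxpowz_subr1 i : mxpowz H Hinv (i - 1) = mxpowz H Hinv i *m Hinv.
Proof. by rewrite -[in RHS](subrK 1 i) mxpowz_addr1 -mulmxA HH.1 mulmx1. Qed.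

Lemma mxpowzD i j :
  mxpowz H Hinv (i + j) = mxpowz H Hinv i *m mxpowz H Hinv j.
Proof.
elim/int_rec: j => [|m IH|m IH]; first by rewrite addr0 mulmx1.
- by rewrite -addn1 PoszD addrA !mxpowz_addr1 IH mulmxA.
- by rewrite -addn1 PoszD opprD addrA !mxpowz_subr1 IH mulmxA.
Qed.

Lemma mxpowz_inv i : mx_inverse (mxpowz H Hinv i) (mxpowz H Hinv (- i)).
Proof. by split; rewrite -mxpowzD ?subrr ?addNr. Qed.

End IntegerPowers.

(** * The powers of [H] for odd [F] and the defining relation *)

Section OddMatrices.
Variables (k : fieldType) (G : groupType) (B : gammaAlg k G) (n : nat).
Variables (g : 'I_n -> G) (F Finv : 'M[B]_n).
Hypotheses (FF : mx_inverse F Finv) (Fo : mx_odd g F).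

Let gV i := (g i)^-1%g.
Let N := mx_twist g F.
(** This is [nabla^-1 F^-1 nabla^-1], the inverse of [nabla F nabla]. *)
Let NV := mx_twist gV Finv.
Let H := N^T *m Finv.
Let Hinv := F *m NV^T.

Let Finvo : mx_odd g Finv := mx_odd_inv FF Fo.

Lemma mx_twist_odd_inv : mx_inverse N NV.
Proof.
split; rewrite -mx_twistM ?FF.1 ?FF.2 ?mx_twist1 // => i j ij.
by apply: Finvo; apply: contraNneq ij => ij; rewrite /gV ij invgK.
Qed.

Let NN := mx_twist_odd_inv.

(** [N^T] and [NV^T] are mutually inverse, since transposition reverses products over the
    commutative [B]. *)
Lemma odd_intertwiner_inv : mx_inverse H Hinv.
Proof.
split; rewrite /H /Hinv -mulmxA.
  by rewrite (mulmxA Finv) FF.2 mul1mx -trmx_mul NN.2 trmx1.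
by rewrite (mulmxA NV^T) -trmx_mul NN.1 trmx1 mul1mx FF.1.
Qed.

Lemma odd_intertwiner_even : mx_even g H.
Proof. by apply: mx_odd_mul_odd => //; apply/mx_odd_tr/mx_odd_twist. Qed.

Lemma odd_intertwiner_inv_even : mx_even g Hinv.
Proof. by apply: mx_odd_mul_odd => //; apply/mx_odd_tr/mx_odd_twist. Qed.

Lemma odd_intertwiner_pow_even i : mx_even g (mxpowz H Hinv i).
Proof.
apply: (mxpowz_ind (P := mx_even g)) => [|M Me|M Me]; first exact: mx_even1.
  exact/mx_evenM/odd_intertwiner_even.
exact/mx_evenM/odd_intertwiner_inv_even.
Qed.

(** [N^T] is [F^T] twisted by the inverses of [g]. The outer twist undoes this and reaches the right
    factor as a twist by those inverses. *)
Lemma mx_twist_odd_intertwiner : mx_twist g H = F^T *m NV.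
Proof.
rewrite /H (mx_twist_tr Fo) (mx_twistM (h := gV)); last first.
  by move=> i j /(mx_odd_twist gV (mx_odd_tr Fo)).
congr (_ *m _); rewrite -[RHS](mx_twistV gV).
by apply/matrixP=> i j; rewrite !mxE /gV invgK.
Qed.

(** This is the defining relation for [nabla H^i] reduced to [B]. Exponent -1 amounts to
    [F (F^T NV)^T = F NV^T F]; exponent 1 follows by inverting, as twisting is multiplicative on
    even matrices. *)
Lemma odd_intertwiner_pow i :
  F *m (mx_twist g (mxpowz H Hinv (- i)))^T = mxpowz H Hinv i *m F.
Proof.
have HH := odd_intertwiner_inv.
have E1 : F *m (mx_twist g H)^T = Hinv *m F.
  by rewrite mx_twist_odd_intertwiner trmx_mul trmxK mulmxA.
have E2 : F *m (mx_twist g Hinv)^T = H *m F.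
  rewrite -[LHS]mul1mx -HH.1 -(mulmxA H) (mulmxA Hinv) -E1 -!mulmxA -trmx_mul.
  rewrite -mx_twistM; last exact: odd_intertwiner_inv_even.
  by rewrite HH.2 mx_twist1 trmx1 mulmx1.
elim/int_rec: i => [|m IH|m IH].
- by rewrite oppr0 /= [X in mx_twist _ X]/(1%:M) mx_twist1 trmx1 mulmx1 [RHS]mul1mx.
(* Transposition reverses the order, so the new factor is split off at the right inside the
   transpose and at the left outside it. *)
- rewrite -addn1 PoszD opprD mxpowz_subr1 // addrC mxpowzD //.
  rewrite (mx_twistM (h := g)); last exact: odd_intertwiner_pow_even.
  by rewrite trmx_mul mulmxA E2 -mulmxA IH mulmxA.
- rewrite -addn1 PoszD !opprD !opprK mxpowz_addr1 // addrC mxpowzD //.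
  rewrite (mx_twistM (h := g)); last exact: (odd_intertwiner_pow_even m).
  by rewrite trmx_mul mulmxA E1 -mulmxA -{1}[Posz m]opprK IH mulmxA.
Qed.

Lemma nabla_pow_rel i :
  orthogonal_rel g F N (nabla B g *m mx_incl (mxpowz H Hinv i)).
Proof.
have [Pi1 Pi2] := mxpowz_inv odd_intertwiner_inv i.
have Pe := odd_intertwiner_pow_even; have [nnV nVn] := nablaV B g.
split=> [i' j|].
  rewrite nabla_mulE; have [<-|ij] := eqVneq (g i') (g j); first exact: cr_degU.
  by rewrite mxE Pe // (klin0 (act_mor B _).1) crU0; apply: cr_deg0.
exists (mx_incl (mxpowz H Hinv (- i)) *m nabla B gV).
  split; rewrite mulmxA.
    by rewrite -(mulmxA (nabla B g)) -mx_inclM Pi1 mx_incl1 mulmx1.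
  by rewrite -(mulmxA (mx_incl _)) nVn mulmx1 -mx_inclM Pi2 mx_incl1.
set P := mxpowz H Hinv (- i).
(* Only the entries are transposed; evenness of [P] lets the group element of the row be replaced by
   that of the column. *)
have -> : (mx_incl P *m nabla B gV)^T = mx_incl P^T *m nabla B gV.
  apply/matrixP=> i' j; rewrite mxE !mul_nablaE !mxE /gV.
  have [->//|ij] := eqVneq (g j) (g i').
  by rewrite Pe // !crU0.
rewrite -[map_mx (bg_r _) N]/(mx_incl N) -[map_mx (bg_s _) F]/(mx_incl F).
rewrite [LHS]mulmxA -[RHS]mulmxA -!mx_inclM -odd_intertwiner_pow -/P.
(* The right side is [nabla] times an odd matrix, hence its twist times [nabla^-1]; the twist is
   identified here. *)
have NE : N *m P^T = mx_twist g (F *m (mx_twist g P)^T).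
  rewrite (mx_twistM (h := gV)) // (mx_twist_tr (h := g)); last exact: Pe.
  by rewrite mx_twistV.
have XO : mx_odd g (F *m (mx_twist g P)^T).
  by rewrite odd_intertwiner_pow; apply: mx_even_mul_odd.
apply/matrixP=> i' j; rewrite mul_nablaE nabla_mulE NE /gV.
have [->//|ij] := eqVneq (g i') (g j)^-1%g.
by rewrite mxE XO // (klin0 (act_mor B _).1) !crU0.
Qed.

End OddMatrices.

(** * The squared antipode on the fundamental matrix *)

Section FundamentalMatrix.
Variables (k : fieldType) (G : groupType) (B : gammaAlg k G) (n : nat).
Variables (g : 'I_n -> G) (F Finv : 'M[B]_n).
Hypotheses (FF : mx_inverse F Finv) (Fo : mx_odd g F).
Variables (A : hopf_algebroid B) (v : 'M[A]_n).
Hypothesis v_free : free_orthogonal g F (mx_twist g F) v.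

Let gV i := (g i)^-1%g.
Let N := mx_twist g F.
Let NV := mx_twist gV Finv.
Let H := N^T *m Finv.
Let Hinv := F *m NV^T.
Let S : A -> A := @antipode _ _ _ A.

(** [crossed_S] turns [g i] times [M i j] into [M i j] times the inverse of [g i], and evenness
    allows [g j] in place of [g i]. *)
Lemma map_mx_crossed_S (M : 'M[B]_n) : mx_even g M ->
  map_mx (@crossed_S _ _ B) (nabla B g *m mx_incl M) = mx_incl M *m nabla B gV.
Proof.
move=> Me; apply/matrixP=> i j; rewrite [LHS]mxE nabla_mulE mul_nablaE mxE.
rewrite crossed_SE -actM mulVg act1 /gV.
by have [->//|ij] := eqVneq (g i) (g j); rewrite Me // !crU0.
Qed.

Lemma antipode2_intertwine :
  map_mx (bg_r A) (mx_twist g H) *m v = map_mx (S \o S) v *m map_mx (bg_s A) H.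
Proof.
have [[SL' [_ SM']] _ Sr' Ss'] := antipode_mor A.
have SL : klinear S := SL'.
have SM x y : S (x * y) = S y * S x := SM' x y.
have Sr b : S (bg_r A b) = bg_s A b := Sr' b.
have Ss b : S (bg_s A b) = bg_r A b := Ss' b.
have [_ [w vw vE]] := fo_rel v_free.
have wE : w = map_mx S v := mx_inverse_uniq vw (fo_antipode v_free).
have S2E : map_mx (S \o S) v *m map_mx (bg_s A) N^T = map_mx (bg_r A) F^T *m w^T.
  (* [S] reverses products and exchanges [r] and [s], so the relation at row [j] and column [i]
     becomes the claim at row [i] and column [j]. *)
  apply/matrixP=> i j; have := congr1 S (congr1 (fun M : 'M_n => M j i) vE).
  rewrite !mxE !(klin_sum _ _ _ SL) => SE.
  by apply: etrans (etrans SE _); apply: eq_bigr => l _;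
    rewrite !mxE SM ?Sr ?Ss wE !mxE.
have rM := bg_r_mor A; have sM := bg_s_mor A.
rewrite /H (alg_map_mxM sM) mulmxA S2E (mx_twist_odd_intertwiner _ Fo).
rewrite (alg_map_mxM rM) -!mulmxA; congr (_ *m _).
have [NN1 NN2] := alg_mx_inverse rM (mx_twist_odd_inv FF Fo).
(* Inserting [NV N = 1] under [r] in front of [w^T] exposes the defining relation, whose factor
   [s(F)] then cancels against [s(F^-1)]. *)
rewrite -[w^T]mul1mx -NN2 -(mulmxA _ _ w^T) vE -!mulmxA; congr (_ *m _).
by rewrite -(alg_map_mxM sM) FF.1 (alg_map_mx1 sM) mulmx1.
Qed.

(** * The characters with value [nabla H^i] on [v] *)

Section Characters.
Variable theta : int -> A -> crossed B.
Hypothesis theta_mor : forall i, bgmorphism (theta i).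
Hypothesis theta_v :
  forall i, map_mx (theta i) v = nabla B g *m mx_incl (mxpowz H Hinv i).

Let P i := mx_twist g (mxpowz H Hinv i).
Let v_deg i j : bg_deg (g i) (g j) (v i j) := (fo_rel v_free).1 i j.

Let thetaE i a b : theta i (v a b) = crU (P i a b) (g a).
Proof. by have /matrixP/(_ a b) := theta_v i; rewrite mxE nabla_mulE. Qed.

(** [lunitE] expects the column group element, the degree in which the next tensor factor starts;
    [runitE] expects that of the row. *)
Let thetaE' i a b : theta i (v a b) = crU (P i a b) (g b).
Proof.
rewrite thetaE /P mxE; have [->//|ab] := eqVneq (g a) (g b).
by rewrite (odd_intertwiner_pow_even FF Fo) // (klin0 (act_mor B _).1) !crU0.
Qed.

Let map_sum (C D : bgalg B) (f : C -> D) I (s : seq I) (h : I -> C) :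
  bgmorphism f -> f (\sum_(i <- s) h i) = \sum_(i <- s) f (h i).
Proof. by move=> fM; apply: klin_sum (bgm_alg fM).1. Qed.

Let v_ext (D : bgalg B) (f h : A -> D) : bgmorphism f -> bgmorphism h ->
  (forall a b, f (v a b) = h (v a b)) -> f =1 h.
Proof.
move=> fM hM fh; apply: (free_orthogonal_ext v_free fM hM).
by apply/matrixP=> a b; rewrite !mxE.
Qed.

(** On [v] the coproduct is a matrix product, and twisting turns [H^i H^j] into the product of the
    two twists. *)
Lemma theta_add i j a :
  lunit (fiber_map (theta i) (theta j) (Delta a)) = theta (i + j) a.
Proof.
have mM := fiber_map_mor (theta_mor i) (theta_mor j).
have lM := lunit_mor (crossed B).
move: a; apply: (v_ext (bgm_comp lM (bgm_comp mM (Delta_mor A)))) => // a b /=.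
rewrite (fo_Delta v_free) (map_sum _ _ mM) (map_sum _ _ lM) thetaE'.
rewrite /P (mxpowzD (odd_intertwiner_inv FF Fo)) (mx_twistM (h := g)); last first.
  exact: odd_intertwiner_pow_even FF Fo _.
rewrite -/(P i) -/(P j) mxE.
rewrite (big_morph (fun x : B => crU x (g b)) (id1 := 0) (op1 := +%R)) //=; first last.
- exact: crU0.
- by move=> x y; apply: crUD.
apply: eq_bigr => l _.
rewrite (fiber_mapE (theta_mor i) (theta_mor j) (v_deg a l) (v_deg l b)).
have := bgm_deg (theta_mor j) (v_deg l b).
rewrite thetaE' => td; rewrite thetaE' (lunitE _ td).
by rewrite [LHS]crUM act1 mul1g.
Qed.

Lemma theta_0 a : theta 0 a = counit a.
Proof.
apply: (v_ext (theta_mor 0) (counit_mor A)) => {}a b.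
rewrite thetaE (fo_counit v_free) /P [mxpowz _ _ _]/(1%:M) mx_twist1 mxE.
by case: eqP => // _; apply: crU0.
Qed.

(** Both sides are morphisms into the co-opposite of the crossed product, and on [v] both give the
    inverse of [nabla H^i]. *)
Lemma theta_S i a : theta i (S a) = crossed_S (theta (- i) a).
Proof.
have tSM := bgm_comp (bgm_coop (theta_mor i)) (antipode_mor A).
have StM := bgm_comp (crossed_S_mor B) (theta_mor (- i)).
move: a; apply: (free_orthogonal_ext v_free tSM StM).
have -> : map_mx (@crossed_S _ _ B \o theta (- i)) v =
    mx_incl (mxpowz H Hinv (- i)) *m nabla B gV.
  rewrite map_mx_comp theta_v map_mx_crossed_S //.
  exact: odd_intertwiner_pow_even FF Fo _.
rewrite map_mx_comp.
have := alg_mx_inverse (bgm_alg (theta_mor i)) (fo_antipode v_free).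
rewrite theta_v => /mx_inverse_uniq; apply.
have [Pi1 Pi2] := mxpowz_inv (odd_intertwiner_inv FF Fo) i.
have [nnV nVn] := nablaV B g.
split; rewrite mulmxA.
  by rewrite -(mulmxA (nabla B g)) -mx_inclM Pi1 mx_incl1 mulmx1.
by rewrite -(mulmxA (mx_incl _)) nVn mulmx1 -mx_inclM Pi2 mx_incl1.
Qed.

Lemma theta_character_group : character_group theta.
Proof.
split; [exact: theta_mor | exact: theta_add | exact: theta_0 | exact: theta_S].
Qed.

(** The intertwiner relation gives [S^2(v) = r(nabla H nabla^-1) v s(H^-1)]; [theta 1] yields the
    left factor through [lunit], and [theta (- 1)] the right one through [runit]. *)
Lemma theta_scaling : scaling theta.
Proof.
have idM := bgm_id A; have DM := Delta_mor A.
have D2M := bgm_comp (fiber_map_mor DM idM) DM.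
have t1M := fiber_map_mor (theta_mor 1) idM.
have ttM := fiber_map_mor t1M (theta_mor (- 1)).
have idM' := bgm_id (crossed B); have lM := fiber_map_mor (lunit_mor A) idM'.
have l1M := bgm_comp (lunit_mor A) (bgm_comp t1M DM).
have rM := runit_mor A.
have xE a l : lunit (fiber_map (theta 1) id (Delta (v a l))) =
    (map_mx (S \o S) v *m map_mx (bg_s A) H) a l.
  rewrite -antipode2_intertwine mxE (fo_Delta v_free).
  rewrite (map_sum _ _ t1M) (map_sum _ _ (lunit_mor A)); apply: eq_bigr => m _.
  rewrite (fiber_mapE (theta_mor 1) idM (v_deg a m) (v_deg m l)) thetaE'.
  by rewrite (lunitE _ (v_deg m l)) [in RHS]mxE.
have SM := antipode2_mor A.
have allM := bgm_comp rM (bgm_comp lM (bgm_comp ttM D2M)).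
apply: (v_ext SM allM) => a b /=.
rewrite (fo_Delta v_free) (map_sum _ _ (fiber_map_mor DM idM)) (map_sum _ _ ttM).
rewrite (map_sum _ _ lM) (map_sum _ _ rM).
have -> : antipode (antipode (v a b)) =
    (map_mx (S \o S) v *m map_mx (bg_s A) H *m map_mx (bg_s A) Hinv) a b.
  rewrite -mulmxA -(alg_map_mxM (bg_s_mor A)) (odd_intertwiner_inv FF Fo).1.
  by rewrite (alg_map_mx1 (bg_s_mor A)) mulmx1 mxE.
rewrite mxE; apply: eq_bigr => l _; rewrite -xE.
have vd := v_deg l b; have Dd := bgm_deg DM (v_deg a l).
rewrite (fiber_mapE DM idM (v_deg a l) vd).
rewrite (fiber_mapE t1M (theta_mor (- 1)) Dd vd).
have td := bgm_deg (theta_mor (- 1)) vd.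
rewrite (fiber_mapE (lunit_mor A) idM' (bgm_deg t1M Dd) td) thetaE.
have xd := bgm_deg l1M (v_deg a l).
(* Moving [s] of an entry of [Hinv] past an element of right degree [g l] applies [g l] to it, which
   is the twist in [P (- 1)]. *)
by rewrite (runitE _ xd) [in LHS]mxE (bg_sC _ xd) /P [in RHS]mxE.
Qed.

End Characters.

End FundamentalMatrix.

(** * Existence of the intertwiner and of the scaling character group *)

Theorem proposition2p5p3 (k : fieldType) (G : groupType) (B : gammaAlg k G)
    (n : nat) (g : 'I_n -> G) (F Finv NFN : 'M[B]_n)
    (F_inv : mx_inverse F Finv)
    (F_odd : mx_incl NFN = nabla B g *m mx_incl F *m nabla B g)
    (A : hopf_algebroid B) (v : 'M[A]_n) (A_free : free_orthogonal g F NFN v) :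
  let H := NFN^T *m Finv in
  intertwiner g H v (map_mx (@antipode k G B A \o @antipode k G B A) v) /\
  exists2 Hinv : 'M[B]_n, mx_inverse H Hinv &
    exists theta : int -> A -> crossed B,
      [/\ character_group theta, scaling theta &
          forall i : int,
            map_mx (theta i) v = nabla B g *m mx_incl (mxpowz H Hinv i)].
Proof.
have [Fo NE] := mx_oddP F_odd; subst NFN.
move=> H; split.
  exists (mx_twist g H); first exact/mx_even_twistE/odd_intertwiner_even.
  exact: (antipode2_intertwine F_inv Fo A_free).
exists (F *m (mx_twist (fun i => (g i)^-1%g) Finv)^T).
  exact: odd_intertwiner_inv.
have [i|theta thetaP] := choice (P := fun i (phi : A -> crossed B) =>
    bgmorphism phi /\ map_mx phi v = nabla B g *m
      mx_incl (mxpowz H (F *m (mx_twist (fun i => (g i)^-1%g) Finv)^T) i)).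
  have [phi [phiM phiE _]] := fo_universal A_free (nabla_pow_rel F_inv Fo i).
  by exists phi.
have theta_mor i := (thetaP i).1; have theta_v i := (thetaP i).2.
exists theta; split=> //.
  exact: (theta_character_group F_inv Fo A_free theta_mor theta_v).
exact: (theta_scaling F_inv Fo A_free theta_mor theta_v).
Qed.
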